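(* Let $\mathfrak{h}\subset\mathfrak{sl}(n,\mathbb R)$ be a subalgebra. Set $\mathfrak{B}_{\mathfrak h}:=\mathbb R\,\mathbb I_{\mathbb R^n}\oplus\mathfrak{h}$. The following are equivalent. (a) $\mathfrak{h}$ is a Cartan subalgebra of $\mathfrak{sl}(n,\mathbb R)$, with toroidal and vector parts of respective dimensions $p$ and $q$. (b) $\mathfrak{B}_{\mathfrak h}=\mathbb R[M]$ for some nonderogatory $M\in\mathfrak{gl}(n,\mathbb R)$ with distinct $2p$ complex and $q$ real eigenvalues, where $2p+q=n$. (c) $\mathfrak{B}_{\mathfrak h}\ltimes\mathbb R^n$ is the direct sum of $p$ copies of $\mathfrak{aff}(\mathbb C)$ and $q$ copies of $\mathfrak{aff}(\mathbb R)$.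
   Context: $\mathfrak{gl}(n,\mathbb R)$ is the Lie algebra of real $n\times n$ matrices (linear operators on $\mathbb R^n$), $\mathfrak{sl}(n,\mathbb R)$ is the subalgebra of traceless ones, and $\mathbb I_{\mathbb R^n}$ is the identity map of $\mathbb R^n$. A Cartan subalgebra of a Lie algebra $\mathcal G$ is a nilpotent subalgebra equal to its own normalizer in $\mathcal G$. A Cartan subalgebra $\mathfrak h$ of a semisimple Lie algebra $\mathcal G$ splits as a direct sum $\mathfrak h=\mathfrak h^+\oplus\mathfrak h^-$ of two subalgebras, called its toroidal part $\mathfrak h^+$ and its vector part $\mathfrak h^-$, where $\mathfrak h^+$ is made only of elements of $\mathfrak h$ whose adjoint operator on $\mathcal G$ has only purely imaginary eigenvalues, and the adjoint operators of elements of $\mathfrak h^-$ have only real eigenvalues. $\mathbb R[M]$ is the space of polynomials in $M$ with real coefficients. A matrix is nonderogatory if its characteristic and minimal polynomials coincide. ''Complex'' eigenvalues means nonreal ones. For a Lie subalgebra $\mathfrak{B}\subset\mathfrak{gl}(n,\mathbb R)$, the semidirect sum $\mathfrak{B}\ltimes\mathbb R^n$ is the vector space $\mathfrak{B}\oplus\mathbb R^n$ with the Lie bracket given, for $a,b\in\mathfrak B$ and $x,y\in\mathbb R^n$, by $[a,b]=[a,b]_{\mathfrak B}$ (the commutator), $[x,y]=0$ and $[a,x]=ax$. $\mathfrak{aff}(\mathbb R)$ is the 2-dimensional real Lie algebra with basis $(e_1,e_2)$ and bracket $[e_1,e_2]=e_2$ (the Lie algebra of the group of affine motions of the real line). $\mathfrak{aff}(\mathbb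 C)$ is the 4-dimensional real Lie algebra with basis $(e_1,e_2,e_3,e_4)$ and nonzero brackets $[e_1,e_3]=e_3$, $[e_1,e_4]=e_4$, $[e_2,e_3]=e_4$, $[e_2,e_4]=-e_3$ (the Lie algebra of the group of affine motions of the complex line, viewed as a real Lie algebra).
   Formalization: In (a) the vector part has dimension p+q-1 instead of q (toroidal part still p), as the original is false: for n=2 and h spanned by diag(1,-1), (a) holds with p=0, q=1 but 2p+q=1, not 2. Also n is at least 1. *)

(* Defs.v *)
(* MathComp world; the real numbers are an arbitrary [R : realType]. *)
From HB Require Import structures.
From mathcomp Require Import all_boot all_order all_algebra.
From mathcomp Require Import reals complex ring.

Set Implicit Arguments.
Unset Strict Implicit.
Unset Printing Implicit Defensive.

Import GRing.Theory.
Local Open Scope ring_scope.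

Reserved Notation "[lie x , y ]" (at level 0, x, y at level 200,
  format "[lie  x ,  y ]").

HB.mixin Record Vector_isLie (R : fieldType) L of Vector R L := {
  lieb : L -> L -> L;
  lieb_linearl : forall y, linear (lieb^~ y);
  lieb_linearr : forall x, linear (lieb x);
  liebb : forall x, lieb x x = 0;
  lieb_jacobi : forall x y z,
    lieb x (lieb y z) + lieb y (lieb z x) + lieb z (lieb x y) = 0
}.

#[short(type="lieAlgType")]
HB.structure Definition LieAlgebra (R : fieldType) :=
  {L of Vector_isLie R L & Vector R L}.

Notation "[lie x , y ]" := (lieb x y) : ring_scope.

Section LieTheory.
Variables (R : fieldType) (L : lieAlgType R).
Implicit Types (x y z : L) (U V W : {vspace L}).

HB.instance Definition _ x :=
  GRing.isLinear.Build R L L _ (lieb x) (lieb_linearr x).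

Lemma liebDr x y z : [lie x, y + z] = [lie x, y] + [lie x, z].
Proof. exact: linearD. Qed.

Lemma liebZr a x y : [lie x, a *: y] = a *: [lie x, y].
Proof. exact: linearZ. Qed.

Lemma liebDl x y z : [lie x + y, z] = [lie x, z] + [lie y, z].
Proof. by have := lieb_linearl z 1 x y; rewrite /= !scale1r. Qed.

Lemma lieb0l y : [lie 0, y] = 0.
Proof. by apply: (addrI [lie 0, y]); rewrite -liebDl !addr0. Qed.

Lemma liebZl a x y : [lie a *: x, y] = a *: [lie x, y].
Proof. by have := lieb_linearl y a x 0; rewrite /= lieb0l !addr0. Qed.

Definition ad x : 'End(L) := linfun (lieb x).

Lemma adE x y : ad x y = [lie x, y]. Proof. by rewrite lfunE. Qed.

(* [U, V], the span of the brackets [u, v] with u in U and v in V *)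
Definition lieprodv U V : {vspace L} :=
  <<[seq [lie u, v] | u <- vbasis U, v <- vbasis V]>>%VS.

Lemma memv_lieprod U V u v :
  u \in U -> v \in V -> [lie u, v] \in lieprodv U V.
Proof.
move=> /coord_vbasis-> /coord_vbasis->; rewrite linear_sum memv_suml // => j _.
rewrite linearZ memvZ //= (big_morph (lieb^~ _) (id1 := 0) (op1 := +%R)).
- apply: memv_suml => i _; rewrite liebZl memvZ //.
  by apply: memv_span; apply: allpairs_f; rewrite mem_nth ?size_tuple.
- by move=> x y /=; rewrite liebDl.
- exact: lieb0l.
Qed.

Lemma lieprodvP U V W :
  reflect (forall u v, u \in U -> v \in V -> [lie u, v] \in W)
          (lieprodv U V <= W)%VS.
Proof.
apply: (iffP idP) => [sUVW u v Uu Vv | sUVW].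
  exact/(subvP sUVW)/memv_lieprod.
by apply/span_subvP=> _ /allpairsP[[u v] /= [Uu Vv ->]]; apply: sUVW;
   apply: vbasis_mem.
Qed.

Record liesub := LieSub {
  lsval :> {vspace L};
  lsvalP : (lieprodv lsval lsval <= lsval)%VS
}.

Lemma memv_lieb (A : liesub) x y : x \in A -> y \in A -> [lie x, y] \in A.
Proof. by move: x y; apply/lieprodvP/lsvalP. Qed.

Definition lower_central U k : {vspace L} := iter k (lieprodv U) U.

Definition lie_nilpotent (h : liesub) : Prop :=
  exists k, lower_central h k = 0%VS.

Definition self_normalizing (h : liesub) : Prop :=
  forall x, (forall y, y \in h -> [lie x, y] \in h) <-> x \in h.

Definition cartan (h : liesub) : Prop :=
  lie_nilpotent h /\ self_normalizing h.

End LieTheory.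

Arguments liesub {R} L.
Notation "{ 'liesub' L }" := (liesub L) (format "{ 'liesub'  L }") : type_scope.

Section SubLie.
Variables (R : fieldType) (L : lieAlgType R) (A : {liesub L}).
Implicit Types x y z : subvs_of A.

Definition sub_lieb x y : subvs_of A := vsproj A [lie vsval x, vsval y].

Lemma val_sub_lieb x y : vsval (sub_lieb x y) = [lie vsval x, vsval y].
Proof. by rewrite vsprojK // memv_lieb ?subvsP. Qed.

Fact sub_lieb_linearl y : linear (sub_lieb^~ y).
Proof.
move=> a x z; apply: subvs_inj.
by rewrite linearP /= !val_sub_lieb linearP liebDl liebZl.
Qed.

Fact sub_lieb_linearr x : linear (sub_lieb x).
Proof.
move=> a y z; apply: subvs_inj.
by rewrite linearP /= !val_sub_lieb linearP.
Qed.

Fact sub_liebb x : sub_lieb x x = 0.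
Proof. by apply: subvs_inj; rewrite val_sub_lieb liebb. Qed.

Fact sub_lieb_jacobi x y z :
  sub_lieb x (sub_lieb y z) + sub_lieb y (sub_lieb z x)
    + sub_lieb z (sub_lieb x y) = 0.
Proof. by apply: subvs_inj; rewrite !linearD /= !val_sub_lieb lieb_jacobi. Qed.

HB.instance Definition _ := Vector_isLie.Build R (subvs_of A)
  sub_lieb_linearl sub_lieb_linearr sub_liebb sub_lieb_jacobi.

End SubLie.

Section DirectSum.
Variable R : fieldType.

Section Pair.
Variables L1 L2 : lieAlgType R.
Implicit Types x y z : (L1 * L2)%type.

Definition pair_lieb x y : (L1 * L2)%type :=
  ([lie x.1, y.1], [lie x.2, y.2]).

Fact pair_lieb_linearl y : linear (pair_lieb^~ y).
Proof.
by move=> a x z; rewrite /pair_lieb /= !liebDl !liebZl.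
Qed.

Fact pair_lieb_linearr x : linear (pair_lieb x).
Proof. by move=> a y z; rewrite /pair_lieb /= !liebDr !liebZr. Qed.

Fact pair_liebb x : pair_lieb x x = 0.
Proof. by rewrite /pair_lieb !liebb. Qed.

Fact pair_lieb_jacobi x y z :
  pair_lieb x (pair_lieb y z) + pair_lieb y (pair_lieb z x)
    + pair_lieb z (pair_lieb x y) = 0.
Proof. by congr (_, _); rewrite /= lieb_jacobi. Qed.

HB.instance Definition _ := Vector_isLie.Build R (L1 * L2)%type
  pair_lieb_linearl pair_lieb_linearr pair_liebb pair_lieb_jacobi.

End Pair.

Section Power.
Variables (I : finType) (L : lieAlgType R).
Implicit Types x y z : {ffun I -> L}.

Definition ffun_lieb x y : {ffun I -> L} := [ffun i => [lie x i, y i]].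

Fact ffun_lieb_linearl y : linear (ffun_lieb^~ y).
Proof. by move=> a x z; apply/ffunP=> i; rewrite !ffunE liebDl liebZl. Qed.

Fact ffun_lieb_linearr x : linear (ffun_lieb x).
Proof. by move=> a y z; apply/ffunP=> i; rewrite !ffunE liebDr liebZr. Qed.

Fact ffun_liebb x : ffun_lieb x x = 0.
Proof. by apply/ffunP=> i; rewrite !ffunE liebb. Qed.

Fact ffun_lieb_jacobi x y z :
  ffun_lieb x (ffun_lieb y z) + ffun_lieb y (ffun_lieb z x)
    + ffun_lieb z (ffun_lieb x y) = 0.
Proof. by apply/ffunP=> i; rewrite !ffunE lieb_jacobi. Qed.

HB.instance Definition _ := Vector_isLie.Build R {ffun I -> L}
  ffun_lieb_linearl ffun_lieb_linearr ffun_liebb ffun_lieb_jacobi.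

End Power.
End DirectSum.

Definition lie_isomorphic (R : fieldType) (L1 L2 : lieAlgType R) : Prop :=
  exists f : {linear L1 -> L2},
    bijective f /\ {morph f : x y / [lie x, y]}.

Section Gl.
Variables (R : fieldType) (n : nat).
Implicit Types A B C : 'M[R]_n.

Definition mx_lieb A B : 'M[R]_n := A *m B - B *m A.

Fact mx_lieb_linearl B : linear (mx_lieb^~ B).
Proof.
move=> a A C; rewrite /mx_lieb mulmxDl mulmxDr -scalemxAl -scalemxAr.
by rewrite scalerBr opprD addrACA.
Qed.

Fact mx_lieb_linearr A : linear (mx_lieb A).
Proof.
move=> a B C; rewrite /mx_lieb mulmxDl mulmxDr -scalemxAl -scalemxAr.
by rewrite scalerBr opprD addrACA.
Qed.

Fact mx_liebb A : mx_lieb A A = 0.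
Proof. exact: subrr. Qed.

Fact mx_lieb_jacobi A B C :
  mx_lieb A (mx_lieb B C) + mx_lieb B (mx_lieb C A)
    + mx_lieb C (mx_lieb A B) = 0.
Proof.
rewrite /mx_lieb !mulmxBl !mulmxBr !mulmxA.
by apply/matrixP=> i j; rewrite !mxE; ring.
Qed.

HB.instance Definition _ := Vector_isLie.Build R 'M[R]_n
  mx_lieb_linearl mx_lieb_linearr mx_liebb mx_lieb_jacobi.

Lemma mx_liebE A B : [lie A, B] = A *m B - B *m A.
Proof. by []. Qed.

Definition sl_vspace : {vspace 'M[R]_n} := 
  lker (linfun (@mxtrace R n : 'M[R]_n -> R^o)).

Lemma mem_sl A : (A \in sl_vspace) = (\tr A == 0).
Proof. by rewrite memv_ker lfunE. Qed.

Fact sl_vspace_sub : (lieprodv sl_vspace sl_vspace <= sl_vspace)%VS.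
Proof.
apply/lieprodvP=> A B _ _.
by rewrite mem_sl mx_liebE raddfB /= mxtrace_mulC subrr.
Qed.

Definition sl_sub : {liesub 'M[R]_n} := LieSub sl_vspace_sub.

End Gl.

Definition sl (R : fieldType) (n : nat) : lieAlgType R := subvs_of (sl_sub R n).

Section Semidirect.
Variables (R : fieldType) (n : nat) (B : {liesub 'M[R]_n}).

Definition semidirect : Type := (subvs_of B * 'cV[R]_n)%type.

HB.instance Definition _ := Vector.on semidirect.

Implicit Types u v w : semidirect.

Definition semi_lieb u v : semidirect :=
  ([lie u.1, v.1], vsval u.1 *m v.2 - vsval v.1 *m u.2).

Fact semi_lieb_linearl v : linear (semi_lieb^~ v).
Proof.
move=> a u w; congr (_, _); first exact: lieb_linearl.
rewrite /= mulmxDl mulmxDr -scalemxAl -scalemxAr.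
by rewrite scalerBr opprD addrACA.
Qed.

Fact semi_lieb_linearr u : linear (semi_lieb u).
Proof.
move=> a v w; congr (_, _); first exact: lieb_linearr.
rewrite /= mulmxDl mulmxDr -scalemxAl -scalemxAr.
by rewrite scalerBr opprD addrACA.
Qed.

Fact semi_liebb u : semi_lieb u u = 0.
Proof. by congr (_, _); rewrite /= ?liebb ?subrr. Qed.

Fact semi_lieb_jacobi u v w :
  semi_lieb u (semi_lieb v w) + semi_lieb v (semi_lieb w u)
    + semi_lieb w (semi_lieb u v) = 0.
Proof.
congr (_, _); first exact: lieb_jacobi.
rewrite /= !val_sub_lieb !mx_liebE !mulmxBl !mulmxBr !mulmxA.
by apply/matrixP=> i j; rewrite !mxE; ring.
Qed.

HB.instance Definition _ := Vector_isLie.Build R semidirect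
  semi_lieb_linearl semi_lieb_linearr semi_liebb semi_lieb_jacobi.

Lemma semi_liebE u v :
  [lie u, v] = ([lie u.1, v.1], vsval u.1 *m v.2 - vsval v.1 *m u.2).
Proof. by []. Qed.

End Semidirect.

Section Aff.
Variable R : fieldType.

(* Coordinates are numbered from 0: the basis vector e_(i+1) is delta_mx 0 i. *)
Definition affR : Type := 'rV[R]_2.

HB.instance Definition _ := Vector.on affR.

Definition affR_lieb (x y : affR) : affR :=
  \row_(k < 2) [:: 0;
                   x 0 0 * y 0 1 - x 0 1 * y 0 0]`_k.

Fact affR_lieb_linearl y : linear (affR_lieb^~ y).
Proof.
move=> a x z; apply/rowP=> -[[|[|//]] ?]; rewrite !mxE /=; ring.
Qed.

Fact affR_lieb_linearr x : linear (affR_lieb x).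
Proof.
move=> a y z; apply/rowP=> -[[|[|//]] ?]; rewrite !mxE /=; ring.
Qed.

Fact affR_liebb x : affR_lieb x x = 0.
Proof. apply/rowP=> -[[|[|//]] ?]; rewrite !mxE /=; ring. Qed.

Fact affR_lieb_jacobi x y z :
  affR_lieb x (affR_lieb y z) + affR_lieb y (affR_lieb z x)
    + affR_lieb z (affR_lieb x y) = 0.
Proof. apply/rowP=> -[[|[|//]] ?]; rewrite !mxE /=; ring. Qed.

HB.instance Definition _ := Vector_isLie.Build R affR
  affR_lieb_linearl affR_lieb_linearr affR_liebb affR_lieb_jacobi.

Definition affC : Type := 'rV[R]_4.

HB.instance Definition _ := Vector.on affC.

Definition affC_lieb (x y : affC) : affC :=
  let c (i j : 'I_4) := x 0 i * y 0 j - x 0 j * y 0 i in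
  \row_(k < 4) [:: 0; 0; c 0 2%:R - c 1 3%:R; c 0 3%:R + c 1 2%:R]`_k.

Fact affC_lieb_linearl y : linear (affC_lieb^~ y).
Proof.
move=> a x z; apply/rowP=> -[[|[|[|[|//]]]] ?]; rewrite !mxE /=; ring.
Qed.

Fact affC_lieb_linearr x : linear (affC_lieb x).
Proof.
move=> a y z; apply/rowP=> -[[|[|[|[|//]]]] ?]; rewrite !mxE /=; ring.
Qed.

Fact affC_liebb x : affC_lieb x x = 0.
Proof. apply/rowP=> -[[|[|[|[|//]]]] ?]; rewrite !mxE /=; ring. Qed.

Fact affC_lieb_jacobi x y z :
  affC_lieb x (affC_lieb y z) + affC_lieb y (affC_lieb z x)
    + affC_lieb z (affC_lieb x y) = 0.
Proof. apply/rowP=> -[[|[|[|[|//]]]] ?]; rewrite !mxE /=; ring. Qed.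

HB.instance Definition _ := Vector_isLie.Build R affC
  affC_lieb_linearl affC_lieb_linearr affC_liebb affC_lieb_jacobi.

Lemma affR_brackets (e := fun i : 'I_2 => delta_mx 0 i : affR) :
  [lie e 0, e 1] = e 1.
Proof. by apply/rowP=> -[[|[|//]] ?]; rewrite !mxE /=; ring. Qed.

Lemma affC_brackets (e := fun i : 'I_4 => delta_mx 0 i : affC) :
  [/\ [lie e 0, e 2%:R] = e 2%:R, [lie e 0, e 3%:R] = e 3%:R,
      [lie e 1, e 2%:R] = e 3%:R & [lie e 1, e 3%:R] = - e 2%:R]
  /\ ([lie e 0, e 1] = 0 /\ [lie e 2%:R, e 3%:R] = 0).
Proof.
by do !split; apply/rowP=> -[[|[|[|[|//]]]] ?]; rewrite !mxE /=; ring.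
Qed.

End Aff.

Section BSub.
Variables (R : fieldType) (n : nat).

(* R I + h; over the reals the sum is direct as soon as n > 0, since elements
   of h have trace 0. *)
Definition B_vspace (h : {vspace sl R n}) : {vspace 'M[R]_n} :=
  (<[1%:M]> + linfun vsval @: h)%VS.

Fact B_vspace_sub (h : {liesub sl R n}) :
  (lieprodv (B_vspace h) (B_vspace h) <= B_vspace h)%VS.
Proof.
apply/lieprodvP=> _ _ /memv_addP[_ /vlineP[a ->] [_ /memv_imgP[x hx ->] ->]]
  /memv_addP[_ /vlineP[b ->] [_ /memv_imgP[y hy ->] ->]].
rewrite !lfunE /=; have ->: [lie a *: 1%:M + vsval x, b *: 1%:M + vsval y]
   = vsval [lie x, y].
  rewrite val_sub_lieb !mx_liebE !mulmxDl !mulmxDr.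
  rewrite -!scalemxAl -!scalemxAr !mul1mx !mulmx1.
  by apply/matrixP=> i j; rewrite !mxE; ring.
apply: (subvP (addvSr _ _)); apply/memv_imgP; exists [lie x, y].
  exact: memv_lieb.
by rewrite lfunE.
Qed.

Definition Bsub (h : {liesub sl R n}) : {liesub 'M[R]_n} :=
  LieSub (B_vspace_sub h).

End BSub.

Section Spectra.
Variable R : realType.

Definition eigenvalueC n (M : 'M[R]_n) : pred R[i] :=
  eigenvalue (map_mx (real_complex R) M).

Definition lfun_eigenvalueC (V : vectType R) (f : 'End(V)) : pred R[i] :=
  eigenvalueC (passmx.mxof (vbasis {:V}) (vbasis {:V}) f).

(* Purely imaginary includes 0.  When L is semisimple and h is a Cartan
   subalgebra of L, the pair (hp, hm) is unique: hp and hm are the toroidal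
   part and the vector part of h.  For L = sl R n and R I + h = R[M], where M
   has 2p nonreal and q real eigenvalues and 2p + q = n, h has dimension n - 1
   and hp has dimension p, so that hm has dimension p + q - 1. *)
Definition toroidal_vector_split (L : lieAlgType R) (h hp hm : {liesub L}) :=
  [/\ (hp + hm)%VS = h :> {vspace L}, (hp :&: hm)%VS = 0%VS,
      forall x, x \in hp ->
        {in lfun_eigenvalueC (ad x), forall z, complex.Re z = 0}
    & forall x, x \in hm ->
        {in lfun_eigenvalueC (ad x), forall z, complex.Im z = 0}].

Definition nonderogatory n (M : 'M[R]_n.+1) : Prop :=
  char_poly M = mxminpoly M.

Definition in_polynomials n (M A : 'M[R]_n.+1) : Prop :=
  exists P : {poly R}, A = horner_mx M P.

Definition has_card (T : eqType) (P : pred T) (k : nat) : Prop :=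
  exists s : seq T, [/\ uniq s, s =i P & size s = k].

(* M has exactly c distinct nonreal and exactly r distinct real eigenvalues. *)
Definition distinct_eigenvalues n (M : 'M[R]_n) (c r : nat) : Prop :=
  has_card [pred z | eigenvalueC M z & complex.Im z != 0] c /\
  has_card [pred z | eigenvalueC M z & complex.Im z == 0] r.

End Spectra.

(* Main.v *)
(* A Cartan subalgebra h of a Lie algebra L contains x whose Fitting null space
   L_0(ad x) is minimal.  For y in h, perturbing ad x to ad (x + t y) shows that
   ad y is nilpotent on L_0(ad x), so Engel's argument applied to L_0(ad x) / h
   and self-normalization give h = L_0(ad x).  For L = sl(n), a generalized
   complex eigenspace of x of dimension >= 2 would put a copy of [e, f] = f,
   f <> 0, inside the complexification of the nilpotent algebra h; hence x has n
   distinct complex eigenvalues, and R I + h, its centralizer, is R[x].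

   When M has simple spectrum, evaluation at one eigenvalue of each conjugate
   pair identifies R[M] with C^p x R^q, and left eigenvectors identify R^n with
   the same R[M]-module.  The eigenvalues of ad P(M) are the differences of the
   P(z), so that together with the vanishing trace they are all imaginary (real)
   if and only if the P(z) are; this yields the dimensions of the two parts.
   Conversely, in a sum of affine algebras the derived algebra is abelian and
   must be the image of R^n; the preimage of a generic element of the torus is
   then a matrix with simple spectrum. *)

Require Import Defs.
From HB Require Import structures.
From mathcomp Require Import all_boot all_order all_algebra.
From mathcomp Require Import boolp reals complex.
From mathcomp Require Import ring lra zify.

Set Implicit Arguments.
Unset Strict Implicit.
Unset Printing Implicit Defensive.

Import Order.TTheory Num.Theory GRing.Theory.
Local Open Scope ring_scope.

(** The three conditions are compared through a fourth: a real matrix [M] with R I + h = R[M],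
    together with a duplicate-free list [ds] of n complex eigenvalues of [M]. The obstacle is that
    diagonalization happens over C, whereas h, its two parts and the isomorphism with the affine sum
    are real. So interpolating polynomials are averaged with their conjugates, and elements of the
    complexification of h are carried as u + i v with u and v in h. The eigenvalue conditions on the
    toroidal and vector parts do not by themselves say that these are maximal; their dimensions are
    found by including them in the largest subspaces of h that satisfy the same conditions. *)

(** * Kernels of powers of a matrix and of its perturbations *)

Lemma horner_eq0_poly0 (F : numDomainType) (p : {poly F}) :
  (forall x, p.[x] = 0) -> p = 0.
Proof.
move=> p0; apply/eqP; apply: contraT => nz_p.
have := @max_poly_roots F p [seq i%:R | i <- iota 0 (size p)] nz_p.
rewrite size_map size_iota ltnn => -> //; first by apply/allP=> x _; apply/eqP.
by rewrite map_inj_uniq ?iota_uniq //; apply: mulrIn; apply: oner_neq0.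
Qed.

(** On [K] both X^k and the characteristic polynomial act as 0, hence so does their gcd by Bezout;
    up to a unit this gcd is X^m, with m bounded by the degree n of the characteristic
    polynomial. *)
Lemma kermx_exp_sub (F : fieldType) n (A : 'M[F]_n) k :
  (kermx (A ^+ k) <= kermx (A ^+ n))%MS.
Proof.
case: n A => [|n] A; first by apply/row_subP => -[].
apply/sub_kermxP; set K := kermx _.
have KA : K *m horner_mx A ('X ^+ k) = 0.
  by rewrite rmorphXn /= horner_mx_X mulmx_ker.
set g := gcdp ('X ^+ k) (char_poly A).
have Kg : K *m horner_mx A g = 0.
  have [[u v] /= /eqpP[[a b] /= /andP[nza nzb] e]] :=
    Bezoutp ('X ^+ k) (char_poly A).
  apply: (scalerI nzb); rewrite scaler0 scalemxAr -linearZ /= -e linearZ /=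
    linearD /=.
  rewrite [u * _]mulrC [v * _]mulrC !rmorphM /=.
  rewrite [horner_mx A (char_poly A)]Cayley_Hamilton mul0r addr0.
  by rewrite -scalemxAr mulmxA KA mul0mx scaler0.
have /dvdp_exp_XsubCP[m le_m] : g %| ('X - 0%:P) ^+ k.
  by rewrite polyC0 subr0 dvdp_gcdl.
rewrite polyC0 subr0 => gm.
have le_mn : (m <= n.+1)%N.
  have := dvdp_leq (monic_neq0 (char_poly_monic A))
    (dvdp_gcdr ('X^k) (char_poly A)).
  by rewrite -/g (eqp_size gm) size_polyXn size_char_poly ltnS.
have Km : K *m A ^+ m = 0.
  case/eqpP: gm => -[a b] /= /andP[nza nzb] e.
  apply: (scalerI nzb); rewrite scaler0 scalemxAr -[A in A ^+ m]horner_mx_X.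
  by rewrite -rmorphXn /= -linearZ /= -e linearZ /= -scalemxAr Kg scaler0.
have -> : A ^+ n.+1 = A ^+ m *m A ^+ (n.+1 - m)
  by rewrite -[_ *m _]exprD subnKC.
by rewrite mulmxA Km mul0mx.
Qed.

(* For t = 0 the row space of (X + t Y) ^+ e complements K := kermx (X ^+ e),
   hence it does for almost all t, and then K (X + t Y) ^+ e = 0 by the bound on
   the rank.  This polynomial identity in t holds for all t; substituting 1 / t
   and clearing denominators gives K (Y + t X) ^+ e = 0, also at t = 0. *)
Lemma kermx_perturb (F : numFieldType) n (X Y : 'M[F]_n) e :
    (kermx (X ^+ e) *m Y <= kermx (X ^+ e))%MS ->
    (kermx (X ^+ (e + e)) <= kermx (X ^+ e))%MS ->
    (forall t, \rank ((X + t *: Y) ^+ e) <= \rank (X ^+ e))%N ->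
  kermx (X ^+ e) *m Y ^+ e = 0.
Proof.
set K := kermx (X ^+ e) => sKY sKX rkQ.
pose Px (A B : 'M[F]_n) : 'M[{poly F}]_n :=
  (map_mx polyC A + 'X *: map_mx polyC B) ^+ e.
have evP t A B : map_mx (horner_eval t) (Px A B) = (A + t *: B) ^+ e.
  rewrite /Px; elim: (e) => [|k IH].
    by rewrite !expr0 map_mx1.
  rewrite !exprS map_mxM IH; congr (_ *m _).
  by apply/matrixP=> i j; rewrite !mxE /= /horner_eval !hornerE.
have hornerP A B u i j :
    ((map_mx polyC K *m Px A B) i j).[u] = (K *m (A + u *: B) ^+ e) i j.
  have /matrixP/(_ i j) : map_mx (horner_eval u) (map_mx polyC K *m Px A B)
      = K *m (A + u *: B) ^+ e.
    rewrite map_mxM evP; congr (_ *m _).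
    by apply/matrixP=> k l; rewrite !mxE /= /horner_eval hornerC.
  by rewrite mxE.
have sKQ t : (K *m (X + t *: Y) ^+ e <= K)%MS.
  have sKXY : (K *m (X + t *: Y) <= K)%MS.
    rewrite mulmxDr addmx_sub //; last by rewrite -scalemxAr scalemx_sub.
    apply/sub_kermxP; rewrite -mulmxA -[X *m _]exprS exprSr.
    by rewrite [_ * X]/(_ *m X) mulmxA mulmx_ker mul0mx.
  elim: (e) => [|k IH]; first by rewrite expr0 mulmx1.
  by rewrite exprSr mulmxA (submx_trans (submxMr _ IH)).
pose Q t := (X + t *: Y) ^+ e.
have KX : K *m X ^+ e = 0 by exact: mulmx_ker.
have full0 : row_full (col_mx (X ^+ e) K).
  rewrite /row_full -addsmxE mxrank_disjoint_sum.
    by rewrite mxrank_ker subnKC ?rank_leq_row.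
  apply/eqP; rewrite -submx0; apply/rV_subP=> v.
  rewrite sub_capmx => /andP[/submxP[u ->] /sub_kermxP uX].
  have /sub_kermxP-> : (u <= K)%MS
    by rewrite (submx_trans _ sKX) //; apply/sub_kermxP;
    rewrite exprD [_ * _]/(_ *m _) mulmxA.
  exact: sub0mx.
have /row_fullP[B BC] := full0.
(* [B] is a left inverse at t = 0 only. This determinant is a polynomial in t with value 1 at 0,
   hence nonzero, and wherever it does not vanish the stacked matrix still has full rank. *)
pose d := \det (map_mx polyC B *m col_mx (Px X Y) (map_mx polyC K)).
have evd t : d.[t] = \det (B *m col_mx (Q t) K).
  rewrite -/(horner_eval t d) /d -det_map_mx map_mxM map_col_mx evP.
  by congr (\det (_ *m col_mx _ _)); apply/matrixP=> i j;
    rewrite !mxE /= /horner_eval hornerC.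
have d0 : d.[0] = 1.
  by rewrite evd /Q scale0r addr0 BC det1.
have KQ t : d.[t] != 0 -> K *m Q t = 0.
  rewrite evd => nzd.
  have fullt : row_full (col_mx (Q t) K).
    have uB : B *m col_mx (Q t) K \in unitmx by rewrite unitmxE unitfE.
    by apply/row_fullP; exists (invmx (B *m col_mx (Q t) K) *m B);
      rewrite -mulmxA mulVmx.
  have := mxrank_sum_cap (Q t) K; rewrite addsmxE (eqP fullt) mxrank_ker => rkE.
  have cap0 : \rank (Q t :&: K)%MS = 0%N.
    have := rkQ t; rewrite -/(Q t); have := rank_leq_row (X ^+ e); move: rkE;
      lia.
  move/eqP: cap0; rewrite mxrank_eq0 => /eqP cap0.
  by apply/eqP; rewrite -submx0 -cap0 sub_capmx submxMl sKQ.
have KQ0 t : K *m Q t = 0.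
  apply/matrixP=> i j; rewrite [RHS]mxE.
  pose p := (map_mx polyC K *m Px X Y) i j.
  have pE u : p.[u] = (K *m Q u) i j.
    exact: hornerP.
  have : p * d = 0.
    apply: horner_eq0_poly0 => u; rewrite hornerM pE.
    have [->|/KQ ->] := eqVneq d.[u] 0; first by rewrite mulr0.
    by rewrite mxE mul0r.
  move/eqP; rewrite mulf_eq0 => /orP[/eqP p0|/eqP dz]; first
    by rewrite -pE p0 horner0.
  by move/eqP: d0; rewrite dz horner0 eq_sym oner_eq0.
have KQ1 t : t != 0 -> K *m (Y + t *: X) ^+ e = 0.
  move=> nzt; have -> : Y + t *: X = t *: (X + t^-1 *: Y).
    by rewrite scalerDr scalerA divff // scale1r addrC.
  have -> : (t *: (X + t^-1 *: Y)) ^+ e = t ^+ e *: Q t^-1.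
    rewrite /Q; elim: (e) => [|k IH]; first by rewrite !expr0 scale1r.
    have mulZ a b (M N : 'M[F]_n) : (a *: M) *m (b *: N) = (a * b) *: (M *m N).
      by rewrite -scalemxAl -scalemxAr scalerA.
    by rewrite !exprS IH; apply: mulZ.
  by rewrite -scalemxAr KQ0 scaler0.
apply/matrixP=> i j; rewrite [RHS]mxE.
pose p := (map_mx polyC K *m Px Y X) i j.
have : p * 'X = 0.
  apply: horner_eq0_poly0 => u; rewrite hornerM hornerX hornerP.
  have [->|/KQ1->] := eqVneq u 0; first by rewrite mulr0.
  by rewrite mxE mul0r.
move/eqP; rewrite mulf_eq0 polyX_eq0 orbF => /eqP p0.
by have := hornerP Y X 0 i j; rewrite -/p p0 horner0 scale0r addr0.
Qed.

Lemma ex_max_measure (T : Type) (P : T -> Prop) (f : T -> nat) (b : nat) :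
    (exists x, P x) -> (forall x, P x -> f x <= b)%N ->
  exists2 x, P x & forall y, P y -> (f y <= f x)%N.
Proof.
move=> [x0 P0] fb; pose Q r := `[< exists2 x, P x & f x = r >].
have exQ : exists r, Q r by exists (f x0); apply/asboolP; exists x0.
have Qb r : Q r -> (r <= b)%N by move=> /asboolP[x /fb ? <-].
case: (ex_maxnP exQ Qb) => r /asboolP[x Px <-] max.
by exists x => // y Py; apply: max; apply/asboolP; exists y.
Qed.

(** * Regular elements of Cartan subalgebras *)

Section CartanRegular.
Variables (F : fieldType) (L : lieAlgType F).
Implicit Types (x y z w : L) (h : {liesub L}).

Lemma lieb_anti x y : [lie x, y] = - [lie y, x].
Proof.
have := liebb (x + y); rewrite liebDl !liebDr !liebb add0r addr0.
by move/eqP; rewrite addr_eq0 => /eqP.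
Qed.

Lemma lieb_leibniz x y z : [lie x, [lie y, z]] =
  [lie [lie x, y], z] + [lie y, [lie x, z]].
Proof.
have := lieb_jacobi x y z.
rewrite (lieb_anti z x) (lieb_anti z [lie x, y]) raddfN /=.
by move/eqP; rewrite -addrA -opprD subr_eq0 addrC => /eqP.
Qed.

Lemma iter_lieb0 x k : iter k (lieb x) 0 = 0.
Proof. by elim: k => //= k ->; rewrite linear0. Qed.

Lemma iter_liebD x k y z :
  iter k (lieb x) (y + z) = iter k (lieb x) y + iter k (lieb x) z.
Proof. by elim: k => //= k ->; rewrite linearD. Qed.

Lemma iter_liebZ x k a y : iter k (lieb x) (a *: y) = a *: iter k (lieb x) y.
Proof. by elim: k => //= k ->; rewrite linearZ. Qed.

(** By the Leibniz rule each application of ad x to [y, z] is spent either on y or on z, so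
    induction runs on a + b. *)
Lemma iter_lieb_bracket x a b y z :
    iter a (lieb x) y = 0 -> iter b (lieb x) z = 0 ->
  iter (a + b) (lieb x) [lie y, z] = 0.
Proof.
move: {2}(a + b)%N (leqnn (a + b)) => m; elim: m a b y z => [|m IH] a b y z.
  by rewrite leqn0 addn_eq0 => /andP[/eqP-> /eqP->] /= -> _; rewrite lieb0l.
case: a => [|a]; first by move=> _ /= -> _; rewrite lieb0l iter_lieb0.
case: b => [|b]; first by move=> _ _ bz;
  rewrite (bz : z = 0) linear0 iter_lieb0.
rewrite addSn ltnS addnS => le_m ay bz.
have e1 : iter (a + b.+1) (lieb x) [lie [lie x, y], z] = 0.
  by apply: IH; rewrite ?addnS // -iterSr.
have e2 : iter (a.+1 + b) (lieb x) [lie y, [lie x, z]] = 0.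
  by apply: IH; rewrite ?addSn // -iterSr.
by rewrite iterSr lieb_leibniz iter_liebD -addnS e1 addnS -addSn e2 addr0.
Qed.

Lemma lower_central_sub h k : (lower_central h k.+1 <= lower_central h k)%VS.
Proof.
elim: k => [|k IH]; first exact: lsvalP.
by apply/lieprodvP=> u v hu kv; apply: memv_lieprod => //; apply: (subvP IH).
Qed.

Lemma lower_central_subh h k : (lower_central h k <= h)%VS.
Proof. by elim: k => [|k IH];
  rewrite ?subvv // (subv_trans (lower_central_sub h k)). Qed.

Lemma iter_lower_central h x y k : x \in h -> y \in h ->
  iter k (lieb x) y \in lower_central h k.
Proof. by move=> hx hy; elim: k => //= k IH; apply: memv_lieprod. Qed.

Lemma liebr_sum x I r (P : pred I) (f : I -> L) :
  [lie \sum_(i <- r | P i) f i, x] = \sum_(i <- r | P i) [lie f i, x].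
Proof. by apply: (big_morph (lieb^~ x)) => [y z|]; rewrite ?liebDl ?lieb0l. Qed.

(* Engel's theorem along the lower central series: going down the series, a
   vector outside h that is sent into h by the next term can be pushed by
   powers of ad y, y in the current term, as these commute modulo h. *)
Lemma self_normalizing_engel h (W : {vspace L}) :
    cartan h ->
    (forall y w, y \in h -> w \in W -> [lie y, w] \in W) ->
    (forall y w, y \in h -> w \in W -> exists k, iter k (lieb y) w \in h) ->
  (W <= h)%VS.
Proof.
move=> [[m hm] sn] stW nilW; apply: contraT => /subvPn[w0 W0 nh0].
(* At j = 0 the term of the series is 0; at j = m it is h itself, and w contradicts
   self-normalization. *)
suff step j : exists w,
  [/\ w \in W, w \notin h & forall y, y \in lower_central h (m - j) ->
  [lie y, w] \in h].
  have [w [_ /negP nhw]] := step m; rewrite subnn => nw; case: nhw.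
  by apply/(sn w) => y hy; rewrite lieb_anti memvN nw.
elim: j => [|j [w [Ww nhw wP]]].
  exists w0; split=> // y; rewrite subn0 hm memv0 => /eqP->.
  by rewrite lieb0l mem0v.
have [lejm|] := leqP m j.
  by exists w; split=> //; move: wP; have /eqP-> : (m - j == 0)%N
    by []; have /eqP-> : (m - j.+1 == 0)%N by rewrite subn_eq0 leqW.
move=> ltjm; have defk : (m - j = (m - j.+1).+1)%N by rewrite -subSn.
move: wP; rewrite defk; set k := (m - j.+1)%N => wP.
suff [v [Wv nhv _ vP]] : exists v, [/\ v \in W, v \notin h,
     (forall y, y \in lower_central h k.+1 -> [lie y, v] \in h) &
     forall y, y \in (vbasis (lower_central h k) : seq L) -> [lie y, v] \in h].
  exists v; split=> // y /coord_vbasis->; rewrite liebr_sum memv_suml // => i _.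
  by rewrite liebZl memvZ // vP // mem_nth ?size_tuple.
have : {subset (vbasis (lower_central h k) : seq L) <= lower_central h k}
  by move=> y /vbasis_mem.
elim: (vbasis _ : seq L) => [_|y s IH sub].
  by exists w; split.
have [u zs|v [Wv nhv v1 v2]] := IH; first by apply: sub; rewrite inE zs orbT.
have ky : y \in lower_central h k by apply: sub; rewrite mem_head.
have hy : y \in h by apply: (subvP (lower_central_subh h k)).
have exq : exists q, iter q (lieb y) v \in h by apply: nilW.
(* The power [q] is the last one that leaves v outside h. The conditions already obtained survive
   the push because [z, y] falls into the next term of the series. *)
case: (ex_minnP exq) => -[|q] hq minq; first by case/negP: nhv.
have inv i : iter i (lieb y) v \in W /\
     forall z, z \in lower_central h k.+1 \/ z \in s ->
       [lie z, iter i (lieb y) v] \in h.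
  elim: i => [|i [iW ih]]; first by split=> // z []; [apply: v1|apply: v2].
  split=> [|z zP]; first exact: stW.
  rewrite iterS lieb_leibniz memvD //; last by apply: memv_lieb; rewrite ?ih.
  apply: ih; left; apply: memv_lieprod => //.
  case: zP => [|zs]; first exact: (subvP (lower_central_subh h k.+1)).
  by apply: (subvP (lower_central_subh h k)); apply: sub; rewrite inE zs orbT.
have [iW ih] := inv q; exists (iter q (lieb y) v); split=> //.
- by apply/negP=> /minq; rewrite ltnn.
- by move=> z zk; apply: ih; left.
- by move=> z; rewrite inE => /orP[/eqP-> //|zs]; apply: ih; right.
Qed.

End CartanRegular.

Section Regular.
Variables (F : numFieldType) (L : lieAlgType F).
Implicit Types (x y z w : L) (h : {liesub L}).
Import VectorInternalTheory.

Definition admx x : 'M[F]_(dim L) := lin1_mx (v2r \o lieb x \o r2v).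

Lemma mul_admx x w : v2r w *m admx x = v2r [lie x, w].
Proof. by rewrite /admx mul_rV_lin1 /= v2rK. Qed.

Lemma mul_admx_exp x w k : v2r w *m admx x ^+ k = v2r (iter k (lieb x) w).
Proof.
elim: k => [|k IH]; first by rewrite expr0 mulmx1.
by rewrite exprSr mulmxA IH mul_admx.
Qed.

Lemma admxDZ x y t : admx (x + t *: y) = admx x + t *: admx y.
Proof.
apply/row_matrixP=> i;
  rewrite !rowE -[delta_mx 0 i]r2vK mulmxDr -scalemxAr !mul_admx.
by rewrite liebDl liebZl linearD linearZ.
Qed.

Lemma v2r_eq0 (w : L) : (v2r w == 0) = (w == 0).
Proof. by rewrite -[0 in LHS](linear0 (@v2r _ _)) (inj_eq (@v2r_inj _ _)). Qed.

Lemma ker_admx x w k : (v2r w <= kermx (admx x ^+ k))%MS =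
  (iter k (lieb x) w == 0).
Proof. by rewrite (sameP sub_kermxP eqP) mul_admx_exp v2r_eq0. Qed.

Lemma iter_lieb_dim x w k : iter k (lieb x) w = 0 ->
  iter (dim L) (lieb x) w = 0.
Proof.
move=> /eqP; rewrite -ker_admx => wk; apply/eqP; rewrite -ker_admx.
exact: submx_trans wk (kermx_exp_sub _ _).
Qed.

(** The rank of the [dim L]-th power of ad y, maximized over y in h, supplies the rank bound of
    [kermx_perturb]. Quantifying over every k frees later uses from [dim L]. *)
Lemma cartan_regular h : cartan h ->
  exists2 x, x \in h & forall w k, iter k (lieb x) w = 0 -> w \in h.
Proof.
move=> ch; have [[m hm] _] := ch; set D := dim L.
have [x hx xmax] : exists2 x, x \in h & forall y, y \in h ->
  (\rank (admx y ^+ D) <= \rank (admx x ^+ D))%N.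
  apply: (@ex_max_measure _ (fun x => x \in h) _ D); first
    by exists 0; apply: mem0v.
  by move=> x _; apply: rank_leq_row.
exists x => // w k wk.
pose W : {vspace L} := mx2vs (kermx (admx x ^+ D)).
have memW v : (v \in W) = (iter D (lieb x) v == 0).
  by rewrite -ker_admx memvE /subsetv !mx2vsK.
have nilh y z : y \in h -> z \in h -> iter m (lieb y) z = 0.
  by move=> hy hz; apply/eqP; rewrite -memv0 -hm iter_lower_central.
(* Nilpotency of h makes m applications of ad x kill y, so m + D applications kill the bracket. *)
have stW y v : y \in h -> v \in W -> [lie y, v] \in W.
  move=> hy; rewrite !memW => /eqP vD.
  by apply/eqP/(@iter_lieb_dim _ _ (m + D)); apply: iter_lieb_bracket => //;
    apply: nilh.
have /subvP : (W <= h)%VS; last by apply; rewrite memW (iter_lieb_dim wk).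
apply: (self_normalizing_engel ch) => // y v hy.
rewrite memW -ker_admx => /submxP[u vE].
exists D; suff -> : iter D (lieb y) v = 0 by exact: mem0v.
apply/eqP; rewrite -v2r_eq0 -mul_admx_exp vE -mulmxA kermx_perturb ?mulmx0 //.
- apply/rV_subP=> _ /submxP[v1 ->]; rewrite mulmxA.
  set v2 := v1 *m _; have : r2v v2 \in W by rewrite memW -ker_admx r2vK submxMl.
  by move/(stW y _ hy); rewrite memW -ker_admx -mul_admx r2vK.
- exact: kermx_exp_sub.
- by move=> t; rewrite -admxDZ; apply: xmax; rewrite memvD ?memvZ.
Qed.
End Regular.

(** Newton's scheme: a new node is corrected by a multiple of the polynomial that vanishes at the
    other nodes. *)
Lemma interpolation (F : fieldType) (s : seq F) (f : F -> F) :
  uniq s -> exists P : {poly F}, {in s, forall z, P.[z] = f z}.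
Proof.
elim: s => [|a s IH] /=; first by exists 0.
move=> /andP[nsa /IH[P PE]]; pose q := \prod_(z <- s) ('X - z%:P).
have qa : q.[a] != 0 by rewrite -[_ == 0]/(root q a) root_prod_XsubC.
exists (P + ((f a - P.[a]) / q.[a]) *: q) => z; rewrite inE hornerD hornerZ.
case/predU1P=> [->|sz]; first by rewrite divfK // addrC subrK.
have /rootP-> : root q z by rewrite root_prod_XsubC.
by rewrite mulr0 addr0 PE.
Qed.

(** * Real matrices with simple complex spectrum *)

Section RealComplex.
Variable R : realType.
Local Notation C := R[i].
Local Notation toC := (real_complex R).
Implicit Types (x y z : C).

Lemma conjcP z : (z == conjc z) = (complex.Im z == 0).
Proof. by case: z => a b; rewrite eq_complex /= eqxx /=; apply/eqP/eqP;
  lra. Qed.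

Lemma Im_conjc z : complex.Im (conjc z) = - complex.Im z.
Proof. by case: z. Qed.

Lemma Re_conjc z : complex.Re (conjc z) = complex.Re z.
Proof. by case: z. Qed.

Lemma Re_add x y : complex.Re (x + y) = complex.Re x + complex.Re y.
Proof. by case: x y => [? ?] [? ?]. Qed.

Lemma Im_add x y : complex.Im (x + y) = complex.Im x + complex.Im y.
Proof. by case: x y => [? ?] [? ?]. Qed.

Lemma Re_sum I r (P : pred I) (f : I -> C) :
  complex.Re (\sum_(i <- r | P i) f i) = \sum_(i <- r | P i) complex.Re (f i).
Proof. by apply: (big_morph (@complex.Re R)) => // x y; rewrite Re_add. Qed.

Lemma Im_sum I r (P : pred I) (f : I -> C) :
  complex.Im (\sum_(i <- r | P i) f i) = \sum_(i <- r | P i) complex.Im (f i).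
Proof. by apply: (big_morph (@complex.Im R)) => // x y; rewrite Im_add. Qed.

Lemma Re_mulr_real z (a : R) : complex.Re (z * toC a) = complex.Re z * a.
Proof. by case: z => ? ? /=; rewrite mulr0 subr0. Qed.

Lemma Im_mulr_real z (a : R) : complex.Im (z * toC a) = complex.Im z * a.
Proof. by case: z => ? ? /=; rewrite mulr0 add0r. Qed.

Lemma Re_sub x y : complex.Re (x - y) = complex.Re x - complex.Re y.
Proof. by case: x y => [? ?] [? ?]. Qed.

Lemma Im_sub x y : complex.Im (x - y) = complex.Im x - complex.Im y.
Proof. by case: x y => [? ?] [? ?]. Qed.

Lemma Re_linear (a : R) x y :
  complex.Re (toC a * x + y) = a * complex.Re x + complex.Re y.
Proof. by rewrite Re_add mulrC Re_mulr_real mulrC. Qed.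

Lemma Im_linear (a : R) x y :
  complex.Im (toC a * x + y) = a * complex.Im x + complex.Im y.
Proof. by rewrite Im_add mulrC Im_mulr_real mulrC. Qed.

Lemma Im0_toC z : complex.Im z = 0 -> z = toC (complex.Re z).
Proof. by case: z => ? ? /= ->. Qed.

Lemma complexP x y : complex.Re x = complex.Re y ->
  complex.Im x = complex.Im y -> x = y.
Proof. by case: x y => [? ?] [? ?] /= -> ->. Qed.

Definition Re_poly (P : {poly C}) : {poly R} := map_poly (@complex.Re R) P.

Lemma Re_polyE (P : {poly C}) :
  map_poly toC (Re_poly P) = 2^-1 *: (P + map_poly conjc P).
Proof.
apply/polyP=> k; rewrite coef_map coefZ coefD coef_map coef_map_id0 //=.
  by rewrite [LHS]ReJ_add mulrC.
by rewrite oppr0.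
Qed.

Lemma horner_conj (P : {poly C}) z : (map_poly conjc P).[z] = conjc P.[conjc z].
Proof. by rewrite -{1}[z]conjcK horner_map. Qed.

Lemma horner_real_conj (P : {poly R}) z :
  (map_poly toC P).[conjc z] = conjc (map_poly toC P).[z].
Proof.
rewrite -[z in RHS]conjcK -horner_conj -map_poly_comp.
by congr horner; apply: eq_map_poly => a /=; rewrite oppr0.
Qed.

(** The conjugate of an interpolating polynomial interpolates the same conjugation-compatible data,
    hence so does their average, whose coefficients are real. *)
Lemma real_interpolation (s : seq C) (f : C -> C) :
    uniq s -> {in s, forall z, conjc z \in s} ->
    {in s, forall z, f (conjc z) = conjc (f z)} ->
  exists P : {poly R}, {in s, forall z, (map_poly toC P).[z] = f z}.
Proof.
move=> us cs fc; have [P PE] := interpolation f us.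
exists (Re_poly P) => z sz; rewrite Re_polyE hornerZ hornerD horner_conj.
rewrite !PE ?cs // fc // conjcK; field => //.
Qed.

Definition mxC m n (A : 'M[R]_(m, n)) : 'M[C]_(m, n) := map_mx toC A.
Definition mxRe m n (A : 'M[C]_(m, n)) : 'M[R]_(m, n) :=
  map_mx (@complex.Re R) A.
Definition mxIm m n (A : 'M[C]_(m, n)) : 'M[R]_(m, n) :=
  map_mx (@complex.Im R) A.
Definition mxJ m n (A : 'M[C]_(m, n)) : 'M[C]_(m, n) := map_mx conjc A.

Lemma mxC_inj m n : injective (@mxC m n).
Proof.
by move=> A B /matrixP e; apply/matrixP=> i j; have := e i j;
  rewrite !mxE => -[].
Qed.

Lemma mxCD m n (A B : 'M[R]_(m, n)) : mxC (A + B) = mxC A + mxC B.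
Proof. exact: map_mxD. Qed.

Lemma mxCB m n (A B : 'M[R]_(m, n)) : mxC (A - B) = mxC A - mxC B.
Proof. exact: map_mxB. Qed.

Lemma mxCM m n p (A : 'M[R]_(m, n)) (B : 'M_(n, p)) :
  mxC (A *m B) = mxC A *m mxC B.
Proof. exact: map_mxM. Qed.

Lemma mxReMr m n p (A : 'M[C]_(m, n)) (B : 'M_(n, p)) :
  mxRe (A *m mxC B) = mxRe A *m B.
Proof.
apply/matrixP=> i j; rewrite !mxE Re_sum; apply: eq_bigr => k _.
by rewrite !mxE Re_mulr_real.
Qed.

Lemma mxImMr m n p (A : 'M[C]_(m, n)) (B : 'M_(n, p)) :
  mxIm (A *m mxC B) = mxIm A *m B.
Proof.
apply/matrixP=> i j; rewrite !mxE Im_sum; apply: eq_bigr => k _.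
by rewrite !mxE Im_mulr_real.
Qed.

Lemma mxJM m n p (A : 'M[C]_(m, n)) (B : 'M_(n, p)) :
  mxJ (A *m B) = mxJ A *m mxJ B.
Proof. exact: map_mxM. Qed.

Lemma mxJC m n (A : 'M[R]_(m, n)) : mxJ (mxC A) = mxC A.
Proof. by apply/matrixP=> i j; rewrite !mxE conjc_real. Qed.

Lemma mxJK m n (A : 'M[C]_(m, n)) : mxJ (mxJ A) = A.
Proof. by apply/matrixP=> i j; rewrite !mxE conjcK. Qed.

Lemma mxJZ m n a (A : 'M[C]_(m, n)) : mxJ (a *: A) = conjc a *: mxJ A.
Proof. exact: map_mxZ. Qed.

Lemma mxReZ m n (a : R) (A : 'M[C]_(m, n)) : mxRe (toC a *: A) = a *: mxRe A.
Proof. by apply/matrixP=> i j; rewrite !mxE mulrC Re_mulr_real mulrC. Qed.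

Lemma mxImZ m n (a : R) (A : 'M[C]_(m, n)) : mxIm (toC a *: A) = a *: mxIm A.
Proof. by apply/matrixP=> i j; rewrite !mxE mulrC Im_mulr_real mulrC. Qed.

Lemma mxReImP m n (A : 'M[C]_(m, n)) : mxRe A = 0 -> mxIm A = 0 -> A = 0.
Proof.
move=> /matrixP reA /matrixP imA; apply/matrixP=> i j.
by apply: complexP; [have := reA i j | have := imA i j]; rewrite !mxE.
Qed.

(* Left eigenvectors are chosen compatibly with complex conjugation; at real
   eigenvalues they are real. *)
Lemma conj_eigenvectors n (M : 'M[R]_n) :
  exists U : C -> 'rV[C]_n, forall z, eigenvalueC M z ->
    [/\ U z != 0, U z *m mxC M = z *: U z & U (conjc z) = mxJ (U z)].
Proof.
pose e z := nz_row (eigenspace (mxC M) z).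
have eP z : eigenvalueC M z -> e z != 0 /\ e z *m mxC M = z *: e z.
  rewrite /eigenvalueC /eigenvalue => nz; split; first by rewrite nz_row_eq0.
  exact/eigenspaceP/nz_row_sub.
(* At a real eigenvalue the real and imaginary parts of [e z] are each zero or an eigenvector; the
   imaginary part serves when the real part vanishes. *)
pose r z := if mxRe (e z) == 0 then mxC (mxIm (e z)) else mxC (mxRe (e z)).
pose U z := if 0 < complex.Im z then e z else if complex.Im z < 0 then mxJ
  (e (conjc z)) else r z.
have UJ z : U (conjc z) = mxJ (U z).
  rewrite /U Im_conjc oppr_gt0 oppr_lt0 conjcK.
  have [lt0|gt0|] := ltgtP 0 (complex.Im z); rewrite ?mxJK //.
  move/esym/eqP; rewrite -conjcP => /eqP <-; rewrite /r.
  by case: ifP; rewrite mxJC.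
have evJ z : eigenvalueC M z -> eigenvalueC M (conjc z).
  move=> /eP[nz ez]; apply/eigenvalueP; exists (mxJ (e z)).
    by rewrite -[map_mx _ M]/(mxC M) -mxJC -mxJM ez mxJZ.
  by rewrite -(inj_eq (can_inj (@mxJK _ _))) mxJK /mxJ map_mx0.
exists U => z Mz; split=> //.
  rewrite /U; case: ifP => _; first by case: (eP z Mz).
  case: ifP => _.
    have [nz _] := eP _ (evJ _ Mz).
    by rewrite -(inj_eq (can_inj (@mxJK _ _))) mxJK /mxJ map_mx0.
  rewrite /r; case: ifPn => [/eqP re0|]; last first.
    by rewrite -(inj_eq (@mxC_inj _ _)) /mxC map_mx0.
  have [nz _] := eP _ Mz; apply: contraNneq nz => im0; apply/eqP/mxReImP => //.
  by apply: mxC_inj; rewrite im0 /mxC map_mx0.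
rewrite /U; case: ifPn => [_|]; first by case: (eP z Mz).
case: ifPn => [_ _|].
  by rewrite -mxJC -mxJM; have [_ ->] := eP _ (evJ _ Mz); rewrite mxJZ conjcK.
rewrite -!leNgt => le0 ge0.
have z0 : complex.Im z = 0 by apply/eqP; rewrite eq_le ge0 le0.
have [_ ez] := eP _ Mz; rewrite /r (Im0_toC z0) in ez *.
case: ifP => _;
  rewrite -mxCM -?mxReMr -?mxImMr ez ?mxReZ ?mxImZ /mxC map_mxZ //.
Qed.

End RealComplex.

Section SimpleSpectrum.
Variable R : realType.
Local Notation C := R[i].
Local Notation toC := (real_complex R).
Local Notation polyC_of := (map_poly toC).

Lemma eigenvalueC_root n (M : 'M[R]_n) z :
  eigenvalueC M z = root (polyC_of (char_poly M)) z.
Proof. by rewrite /eigenvalueC eigenvalue_root_char map_char_poly. Qed.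

Lemma eigenvalueCJ n (M : 'M[R]_n) z : eigenvalueC M z ->
  eigenvalueC M (conjc z).
Proof.
rewrite !eigenvalueC_root => /rootP z0; apply/rootP.
by rewrite horner_real_conj z0 conjc0.
Qed.

(** The list fixes an order of the eigenvalues, which later indexes the rows of the eigenvector
    matrix. *)
Definition simple_spectrum n (M : 'M[R]_n) (ds : seq C) :=
  [/\ uniq ds, size ds = n & {in ds, forall z, eigenvalueC M z}].

Section FixedMatrix.
Variables (n : nat) (M : 'M[R]_n.+1) (ds : seq C).
Hypothesis M_ds : simple_spectrum M ds.

Lemma simple_char_poly : polyC_of (char_poly M) = \prod_(z <- ds) ('X - z%:P).
Proof.
have [us sz ev] := M_ds.
rewrite [LHS](all_roots_prod_XsubC _ _ _ :
  _ = _ *: \prod_(z <- ds) ('X - z%:P)).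
- by rewrite lead_coef_map (monicP (char_poly_monic M)) rmorph1 scale1r.
- by rewrite size_map_poly size_char_poly sz.
- by apply/allP=> z /ev; rewrite eigenvalueC_root.
- by rewrite uniq_rootsE.
Qed.

Lemma simple_eigenvalueC z : eigenvalueC M z = (z \in ds).
Proof. by rewrite eigenvalueC_root simple_char_poly root_prod_XsubC. Qed.

Lemma simple_conj : {in ds, forall z, conjc z \in ds}.
Proof. by move=> z; rewrite -!simple_eigenvalueC; apply: eigenvalueCJ. Qed.

(** As its roots are distinct, the characteristic polynomial divides P over C, hence over R, and
    Cayley-Hamilton applies. *)
Lemma horner_mx_simple_eq0 (P : {poly R}) :
  {in ds, forall z, (polyC_of P).[z] = 0} -> horner_mx M P = 0.
Proof.
move=> P0; have [us _ _] := M_ds.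
suff /dvdpP[q ->] : char_poly M %| P.
  by rewrite rmorphM /= [horner_mx M (char_poly M)]Cayley_Hamilton mulr0.
rewrite -(dvdp_map toC) simple_char_poly; apply: uniq_roots_dvdp; last
  by rewrite uniq_rootsE.
by apply/allP=> z /P0/rootP.
Qed.

Lemma eigen_horner_mx (F : fieldType) m (A : 'M[F]_m.+1) (v : 'rV_m.+1) a P :
  v *m A = a *: v -> v *m horner_mx A P = P.[a] *: v.
Proof.
move=> vA; elim/poly_ind: P => [|P c IH]; first
  by rewrite rmorph0 mulmx0 horner0 scale0r.
rewrite rmorphD rmorphM /= horner_mx_X horner_mx_C mulmxDr mulmxA IH -scalemxAl
  vA.
by rewrite mul_mx_scalar scalerA hornerMXaddC scalerDl.
Qed.

Lemma eigen_horner_mxC (v : 'rV[C]_n.+1) z (P : {poly R}) :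
  v *m mxC M = z *: v -> v *m mxC (horner_mx M P) = (polyC_of P).[z] *: v.
Proof. by move=> vM; rewrite /mxC map_horner_mx; apply: eigen_horner_mx. Qed.

Definition eigen_mx (U : C -> 'rV[C]_n.+1) : 'M[C]_n.+1 :=
  \matrix_(i < n.+1) U ds`_i.

Definition eigen_diag : 'rV[C]_n.+1 := \row_(i < n.+1) ds`_i.

Lemma nth_simple (i : 'I_n.+1) : ds`_i \in ds.
Proof. by have [_ sz _] := M_ds; rewrite mem_nth ?sz. Qed.

Lemma nth_simple_inj : injective (fun i : 'I_n.+1 => ds`_i).
Proof.
have [us sz _] := M_ds => i j /eqP; rewrite nth_uniq ?sz ?ltn_ord //.
by move/eqP/val_inj.
Qed.

Section Eigenvectors.
Variable U : C -> 'rV[C]_n.+1.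
Hypothesis U_neq0 : {in ds, forall z, U z != 0}.
Hypothesis U_eigen : {in ds, forall z, U z *m mxC M = z *: U z}.
Local Notation S := (eigen_mx U).

(** A linear relation between the rows, multiplied by a polynomial in M that is 1 at one eigenvalue
    and 0 at the others, isolates a single coefficient. *)
Lemma eigen_mx_unit : S \in unitmx.
Proof.
have [us sz _] := M_ds.
rewrite -row_free_unit -kermx_eq0; apply/rowV0P => u /sub_kermxP uS.
apply/rowP=> i; rewrite mxE.
have [P PE] := interpolation (fun z => (z == ds`_i)%:R) us.
have := congr1 (mulmx^~ (horner_mx (mxC M) P)) uS; rewrite /= mul0mx.
rewrite [u *m S]mulmx_sum_row mulmx_suml (bigD1 i) //= big1 => [|j nji];
  last first.
  rewrite rowK -scalemxAl (eigen_horner_mx _ (U_eigen (nth_simple j))) PE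
    ?nth_simple //.
  by rewrite (inj_eq nth_simple_inj) (negPf nji) scale0r scaler0.
rewrite addr0 rowK -scalemxAl (eigen_horner_mx _ (U_eigen (nth_simple i))) PE
  ?nth_simple //.
rewrite eqxx scale1r => /eqP; rewrite scaler_eq0 => /orP[/eqP //|].
by rewrite (negPf (U_neq0 (nth_simple i))).
Qed.

Lemma eigen_mxM : S *m mxC M = diag_mx eigen_diag *m S.
Proof.
apply/row_matrixP=> i; rewrite !row_mul rowK U_eigen ?nth_simple //.
by rewrite row_diag_mx -scalemxAl -rowE rowK mxE.
Qed.

Lemma eigenvectors_span (v : 'cV[C]_n.+1) :
  {in ds, forall z, U z *m v = 0} -> v = 0.
Proof.
move=> Uv; apply: (can_inj (mulKmx eigen_mx_unit)); rewrite mulmx0.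
by apply/row_matrixP=> i; rewrite row_mul rowK Uv ?nth_simple // row0.
Qed.

Definition to_eigen (Z : 'M[C]_n.+1) := S *m Z *m invmx S.

Lemma to_eigenM Y Z : to_eigen (Y *m Z) = to_eigen Y *m to_eigen Z.
Proof. by rewrite /to_eigen !mulmxA mulmxKV ?eigen_mx_unit. Qed.

Lemma to_eigenB Y Z : to_eigen (Y - Z) = to_eigen Y - to_eigen Z.
Proof. by rewrite /to_eigen mulmxBr mulmxBl. Qed.

Lemma to_eigenZ a Z : to_eigen (a *: Z) = a *: to_eigen Z.
Proof. by rewrite /to_eigen -scalemxAr -scalemxAl. Qed.

Lemma to_eigen_inj : injective to_eigen.
Proof.
by move=> Y Z /(can_inj (mulmxK _));
  rewrite unitmx_inv => /(_ eigen_mx_unit)/(can_inj (mulKmx eigen_mx_unit)).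
Qed.

Lemma to_eigen_tr Z : \tr (to_eigen Z) = \tr Z.
Proof. by rewrite /to_eigen mxtrace_mulC mulmxA mulVmx ?mul1mx ?eigen_mx_unit.
  Qed.

Lemma to_eigen_horner (P : {poly R}) :
  to_eigen (mxC (horner_mx M P)) = diag_mx (\row_i (polyC_of P).[ds`_i]).
Proof.
rewrite /to_eigen; apply: (can_inj (mulmxK eigen_mx_unit));
  rewrite mulmxKV ?eigen_mx_unit //.
apply/row_matrixP=> i;
  rewrite !row_mul rowK row_diag_mx -scalemxAl -rowE rowK mxE.
by apply: eigen_horner_mxC; rewrite U_eigen ?nth_simple.
Qed.

Lemma mul_diag_commE (d : 'rV[C]_n.+1) (Z : 'M[C]_n.+1) i j :
  (diag_mx d *m Z - Z *m diag_mx d) i j = (d 0 i - d 0 j) * Z i j.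
Proof. by rewrite mul_mx_diag mul_diag_mx !mxE; ring. Qed.

(** If [U z] is a left eigenvector of A, this is its eigenvalue, as a nonzero row times its
    pseudoinverse is 1. The formula is linear in A on all matrices. *)
Definition ev z (A : 'M[R]_n.+1) : C := (U z *m mxC A *m pinvmx (U z)) 0 0.

Lemma ev_linear z k A B : ev z (k *: A + B) = toC k * ev z A + ev z B.
Proof.
rewrite /ev mxCD [mxC (k *: A)]map_mxZ mulmxDr mulmxDl -scalemxAr -scalemxAl.
by rewrite !mxE.
Qed.

Lemma ev_horner z (P : {poly R}) :
  z \in ds -> ev z (horner_mx M P) = (polyC_of P).[z].
Proof.
move=> dz; rewrite /ev (eigen_horner_mxC _ (U_eigen dz)) -scalemxAl mulmxVp.
  by rewrite !mxE mulr1.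
by rewrite /row_free rank_rV U_neq0.
Qed.

End Eigenvectors.

Lemma simple_eigenvectors :
  exists U : C -> 'rV[C]_n.+1, [/\ {in ds, forall z, U z != 0},
    {in ds, forall z, U z *m mxC M = z *: U z} &
    {in ds, forall z, U (conjc z) = mxJ (U z)}].
Proof.
have [U UP] := conj_eigenvectors M; exists U.
by split=> z; rewrite -simple_eigenvalueC => /UP[].
Qed.

Lemma simple_horner_tr (P : {poly R}) :
  toC (\tr (horner_mx M P)) = \sum_(z <- ds) (polyC_of P).[z].
Proof.
have [U [U0 UM _]] := simple_eigenvectors; have [_ sz _] := M_ds.
have -> : toC (\tr (horner_mx M P)) = \tr (mxC (horner_mx M P)).
  by rewrite /mxC -trace_map_mx.
rewrite -(to_eigen_tr U0 UM) (to_eigen_horner U0 UM) mxtrace_diag.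
by rewrite [RHS](big_nth 0) sz big_mkord; apply: eq_bigr => i _; rewrite mxE.
Qed.

Lemma to_eigen_M U (U0 : {in ds, forall z, U z != 0})
    (UM : {in ds, forall z, U z *m mxC M = z *: U z}) :
  to_eigen U (mxC M) = diag_mx eigen_diag.
Proof. by rewrite /to_eigen (eigen_mxM UM) mulmxK ?(eigen_mx_unit U0 UM). Qed.

(** In the eigenbasis A commutes with a diagonal matrix of distinct entries, so it is diagonal and
    equals P(M) for a complex interpolating P. As A and M are real, the conjugate of P represents A
    too, and the average [Re_poly P] has real coefficients. *)
Lemma simple_commutant (A : 'M[R]_n.+1) :
  [lie M, A] = 0 -> exists P : {poly R}, A = horner_mx M P.
Proof.
have [U [U0 UM UJ]] := simple_eigenvectors; have [us sz _] := M_ds => MA.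
pose T := to_eigen U (mxC A).
have Tdiag i j : i != j -> T i j = 0.
  move=> nij; have := mul_diag_commE eigen_diag T i j.
  rewrite -(to_eigen_M U0 UM) -!(to_eigenM U0 UM) -to_eigenB -!mxCM -mxCB
    -mx_liebE MA.
  rewrite /mxC map_mx0 /to_eigen mulmx0 mul0mx !mxE => /esym/eqP.
  rewrite mulf_eq0 subr_eq0 (inj_eq nth_simple_inj) (negPf nij) /=.
  by move/eqP.
(* On [ds] the index i is unique and the default 0 is never taken. *)
have [P PE] :=
  interpolation
  (fun z => oapp (fun i => T i i) 0 [pick i : 'I_n.+1 | ds`_i == z]) us.
have PT i : P.[ds`_(i : 'I_n.+1)] = T i i.
  rewrite PE ?nth_simple //; case: pickP => [j|/(_ i)]; last by rewrite eqxx.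
  by rewrite (inj_eq nth_simple_inj) => /eqP->.
have AP : mxC A = horner_mx (mxC M) P.
  apply: (to_eigen_inj U0 UM); rewrite -/T.
  apply: (can_inj (mulmxK (eigen_mx_unit U0 UM))).
  rewrite [to_eigen _ (horner_mx _ _)]/to_eigen [RHS]mulmxKV
    ?(eigen_mx_unit U0 UM) //.
  apply/row_matrixP=> i; rewrite [LHS]row_mul [RHS]row_mul [in RHS]rowK.
  rewrite (eigen_horner_mx _ (UM _ (nth_simple i))) PT.
  have -> : row i T = T i i *: delta_mx 0 i.
    apply/rowP=> j; rewrite [LHS]mxE [RHS]mxE [delta_mx _ _ _ _]mxE eqxx /=
      eq_sym.
    by have [->|/Tdiag->] := eqVneq i j; rewrite ?mulr1 ?mulr0.
  by rewrite -scalemxAl -rowE rowK.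
exists (Re_poly P); apply: mxC_inj.
rewrite /mxC map_horner_mx Re_polyE linearZ linearD /= -AP.
have -> : horner_mx (map_mx toC M) (map_poly conjc P) = mxC A.
  rewrite -[mxC A]mxJC AP /mxJ map_horner_mx; congr horner_mx.
  by rewrite -[LHS]mxJC.
apply/matrixP=> i j; rewrite !mxE; field.
by [].
Qed.

(** ad M is diagonalizable: in the eigenbasis it multiplies the entry (i, j) by a difference of
    eigenvalues, and a scalar whose square kills an entry already kills it. *)
Lemma simple_double_commutant (A : 'M[R]_n.+1) :
  [lie M, [lie M, A]] = 0 -> [lie M, A] = 0.
Proof.
have [U [U0 UM UJ]] := simple_eigenvectors => MMA.
have adE X i j : to_eigen U (mxC [lie M, X]) i j =
  (ds`_i - ds`_j) * to_eigen U (mxC X) i j.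
  rewrite mx_liebE mxCB !mxCM to_eigenB !(to_eigenM U0 UM) (to_eigen_M U0 UM).
  by rewrite mul_diag_commE !mxE.
apply: mxC_inj; apply: (to_eigen_inj U0 UM); apply/matrixP=> i j.
have e0 : to_eigen U (mxC 0) = 0
  by rewrite /mxC map_mx0 /to_eigen mulmx0 mul0mx.
have := adE [lie M, A] i j; rewrite MMA e0 adE.
move: (to_eigen U (mxC A) i j) => z; rewrite !mxE => /esym/eqP.
rewrite mulrA -expr2 mulf_eq0 sqrf_eq0 => /orP[]/eqP->; first by rewrite mul0r.
by rewrite mulr0.
Qed.

End FixedMatrix.
End SimpleSpectrum.

(** * Cartan subalgebras of sl(n) *)

(** If every generalized eigenspace is at most a line, their sum, which is the whole space, has
    dimension at most the number of distinct roots. *)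
Lemma geigenspace_dichotomy (F : closedFieldType) n (A : 'M[F]_n.+1) :
    (exists ds : seq F,
      [/\ uniq ds, size ds = n.+1 & {in ds, forall z, eigenvalue A z}]) \/
  exists a, (1 < \rank (geigenspace A a))%N.
Proof.
have [rs] := closed_field_poly_normal (char_poly A).
rewrite (monicP (char_poly_monic A)) scale1r => chE.
have sz : size rs = n.+1.
  by have := size_char_poly A; rewrite chE size_prod_XsubC => -[].
pose ds := undup rs.
have [[i rk]|small] := pselect
  (exists i : 'I_(size ds), (1 < \rank (geigenspace A ds`_i))%N).
  by right; exists ds`_i.
left; exists ds; split; first exact: undup_uniq; last first.
  by move=> z; rewrite mem_undup eigenvalue_root_char chE root_prod_XsubC.
apply/eqP; rewrite eqn_leq -{1}sz size_undup /=.
pose q := \prod_(z <- ds) ('X - z%:P).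
(* The uniform exponent n.+1 covers all multiplicities: each of the n.+1 roots in [rs] uses up one
   factor [q]. *)
have dvq : mxminpoly A %| \prod_(i < size ds) ('X - (ds`_i)%:P) ^+ n.+1.
  apply: (dvdp_trans (mxminpoly_dvd_char A)).
  have -> : \prod_(i < size ds) ('X - (ds`_i)%:P) ^+ n.+1 = q ^+ n.+1.
    by rewrite /q [in RHS](big_nth 0) big_mkord prodrXl.
  rewrite chE -sz; have : {subset rs <= ds} by move=> z; rewrite mem_undup.
  elim: (rs) => [|z s IH] sub; first by rewrite big_nil dvd1p.
  rewrite big_cons exprS dvdp_mul ?IH //.
    by rewrite dvdp_XsubCl root_prod_XsubC sub ?mem_head.
  by move=> y sy; apply: sub; rewrite inE sy orbT.
have := kermxpoly_prod A (P := predT)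
  (p_ := fun i : 'I_(size ds) => ('X - (ds`_i)%:P) ^+ n.+1).
case=> [i j _ _ nji|rkE _].
  by rewrite coprimep_expr ?coprimep_expl // coprimep_XsubC root_XsubC nth_uniq
    ?undup_uniq.
rewrite -(mxrank1 F n.+1) -(kermxpoly_min dvq) rkE.
apply: leq_trans (leq_of_leqif (mxrank_sum_leqif _)) _ => /=.
rewrite -[X in (_ <= X)%N]card_ord -sum1_card; apply: leq_sum => i _.
by rewrite leqNgt; apply/negP => rk; apply: small; exists i.
Qed.

(** ad A is left minus right multiplication by T = A - a; the two commute, so their exponents of
    nilpotency on Z add up. *)
Lemma iter_lieb_mx0 (F : fieldType) n (A Z : 'M[F]_n) a i j :
    (A - a%:M) ^+ i *m Z = 0 -> Z *m (A - a%:M) ^+ j = 0 ->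
  iter (i + j) (lieb A) Z = 0.
Proof.
set T := A - a%:M; have adT X : lieb A X = T *m X - X *m T.
  rewrite mx_liebE /T mulmxBl mulmxBr mul_scalar_mx mul_mx_scalar.
  by rewrite opprB addrA subrK.
move: {2}(i + j)%N (leqnn (i + j)) => m; elim: m i j Z => [|m IH] i j Z.
  by rewrite leqn0 addn_eq0 => /andP[/eqP-> /eqP->]; rewrite expr0 mul1mx.
case: i => [|i]; first by rewrite expr0 mul1mx => _ ->; rewrite iter_lieb0.
case: j => [|j]; first by rewrite expr0 mulmx1 => _ _ ->; rewrite iter_lieb0.
rewrite addSn ltnS addnS => le_m Zi Zj.
have TS k : T ^+ k.+1 = T *m T ^+ k by rewrite exprS.
have TSr k : T ^+ k.+1 = T ^+ k *m T by rewrite exprSr.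
have e1 : iter (i + j.+1) (lieb A) (T *m Z) = 0.
  by apply: IH; rewrite ?addnS // ?mulmxA -?TSr // -mulmxA Zj mulmx0.
have e2 : iter (i.+1 + j) (lieb A) (Z *m T) = 0.
  by apply: IH; rewrite ?addSn // -?mulmxA -?TS // mulmxA Zi mul0mx.
have e3 : iter (i.+1 + j) (lieb A) (- (Z *m T)) = 0.
  by rewrite -scaleN1r iter_liebZ e2 scaler0.
by rewrite iterSr adT iter_liebD -addnS e1 addnS -addSn e3 addr0.
Qed.

(* Matrices living on a generalized eigenspace, extended by 0 to its invariant
   complement, are killed by a power of ad A. *)
Lemma geigenspace_sl2 (F : numFieldType) n (A : 'M[F]_n.+1) a :
    (1 < \rank (geigenspace A a))%N ->
  exists E Z : 'M[F]_n.+1, exists k,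
    [/\ [lie E, Z] = Z /\ Z != 0, \tr E = 0, \tr Z = 0,
        iter k (lieb A) E = 0 & iter k (lieb A) Z = 0].
Proof.
rewrite geigenspaceE; set T := A - a%:M; set K := n.+1; set G := kermx _ => rk.
have GT : (G :&: T ^+ K)%MS = 0.
  apply/eqP; rewrite -submx0; apply/rV_subP=> v.
  rewrite sub_capmx => /andP[/sub_kermxP vT /submxP[u uE]].
  have uG : (u <= G)%MS.
    apply: submx_trans (kermx_exp_sub T (K + K)); apply/sub_kermxP.
    by rewrite exprD -[_ * _]/(_ *m _) mulmxA -uE.
  by rewrite uE (sub_kermxP uG) sub0mx.
pose Rw := row_base G; pose P := proj_mx G (T ^+ K).
have RwP : Rw *m P = Rw by rewrite proj_mx_id // eq_row_base.
(* The rows of [Rw] span the generalized eigenspace, and [Cl] reads coordinates in them along the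
   image of T^K; so b -> Cl b Rw is multiplicative and preserves the trace. *)
have [Cl RC TC] : exists2 Cl, Rw *m Cl = 1%:M & T ^+ K *m Cl = 0.
  exists (P *m pinvmx Rw); first by rewrite mulmxA RwP mulmxVp // row_base_free.
  by rewrite mulmxA proj_mx_0 // mul0mx.
have RT : Rw *m T ^+ K = 0 by apply/sub_kermxP; rewrite eq_row_base.
move: Rw RC RT {RwP} => Rw RC RT.
pose i0 : 'I_(\rank G) := Ordinal (ltnW rk);
  pose i1 : 'I_(\rank G) := Ordinal rk.
have n01 : (i0 == i1) = false by [].
(* Subtracting the second unit makes e traceless, so that its extension lies in sl; the factor 1/2
   restores [e, f] = f. *)
pose e := 2^-1 *: (delta_mx i0 i0 - delta_mx i1 i1) : 'M[F]_(\rank G).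
pose f := delta_mx i0 i1 : 'M[F]_(\rank G).
have mulCR (b c : 'M_(\rank G)) :
  (Cl *m b *m Rw) *m (Cl *m c *m Rw) = Cl *m (b *m c) *m Rw.
  by rewrite -!mulmxA (mulmxA Rw Cl) RC mul1mx.
have trCR (b : 'M_(\rank G)) : \tr (Cl *m b *m Rw) = \tr b.
  by rewrite mxtrace_mulC mulmxA RC mul1mx.
have iterCR (b : 'M_(\rank G)) : iter (K + K) (lieb A) (Cl *m b *m Rw) = 0.
  apply: (@iter_lieb_mx0 _ _ _ _ a); rewrite -/T.
    by rewrite (mulmxA (T ^+ K)) (mulmxA (T ^+ K)) TC !mul0mx.
  by rewrite -(mulmxA _ Rw) RT mulmx0.
have tr_delta i j : \tr (delta_mx i j : 'M[F]_(\rank G)) = (i == j)%:R.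
  rewrite /mxtrace (bigD1 i) //= big1 => [|k nki]; last
    by rewrite mxE (negPf nki).
  by rewrite mxE eqxx addr0.
exists (Cl *m e *m Rw), (Cl *m f *m Rw), (K + K)%N; split=> //.
- rewrite mx_liebE !mulCR -mulmxBl -mulmxBr; split; last first.
    apply/eqP=> /(congr1 (fun X => Rw *m X *m Cl)).
    rewrite !mulmxA RC mul1mx -mulmxA RC mulmx1 mulmx0 mul0mx
      => /matrixP/(_ i0 i1).
    by rewrite !mxE !eqxx => /eqP; rewrite oner_eq0.
  congr (_ *m _ *m _); rewrite /e /f -scalemxAl -scalemxAr mulmxBl mulmxBr.
  rewrite !mul_delta_mx_cond eqxx [i1 == i0]eq_sym n01 !mulr1n !mulr0n subr0
    sub0r.
  by rewrite scalerN opprK -scalerDl -[2^-1]mul1r -splitr scale1r.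
- by rewrite trCR linearZ /= raddfB /= !tr_delta !eqxx subrr mulr0.
- by rewrite trCR tr_delta n01.
Qed.

Lemma sl_tr0 (F : numFieldType) n (x : sl F n.+1) : \tr (vsval x) = 0.
Proof. by have := subvsP x; rewrite mem_sl => /eqP. Qed.

Lemma sl_lift (F : numFieldType) n (A : 'M[F]_n.+1) : \tr A = 0 -> exists x :
  sl F n.+1, vsval x = A.
Proof.
move=> A0; have Asl : A \in sl_vspace F n.+1 by rewrite mem_sl A0.
by exists (vsproj (sl_sub F n.+1) A); rewrite vsprojK.
Qed.

Section CartanSpectrum.
Variables (R : realType) (n : nat).
Local Notation C := R[i].
Local Notation L := (sl R n.+1).
Implicit Types (x y : L) (h : {liesub L}).

Definition slC x : 'M[C]_n.+1 := mxC (vsval x).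

Lemma vsval_lieb x y : vsval [lie x, y] = [lie vsval x, vsval y].
Proof. exact: val_sub_lieb. Qed.

Lemma slCM x y : slC [lie x, y] = [lie slC x, slC y].
Proof. by rewrite /slC vsval_lieb !mx_liebE mxCB !mxCM. Qed.

Lemma slC0 : slC 0 = 0.
Proof. by rewrite /slC linear0 /mxC map_mx0. Qed.

Lemma slCD x y : slC (x + y) = slC x + slC y.
Proof. by rewrite /slC linearD mxCD. Qed.

Lemma slCZ (a : R) x : slC (a *: x) = real_complex R a *: slC x.
Proof. by rewrite /slC linearZ /mxC map_mxZ. Qed.

Lemma mx_ReIm m p (Z : 'M[C]_(m, p)) : Z = mxC (mxRe Z) + 'i%C *: mxC (mxIm Z).
Proof. by apply/matrixP=> i j; rewrite !mxE [LHS]complexE. Qed.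

Lemma sl_ReIm (Z : 'M[C]_n.+1) : \tr Z = 0 -> exists x y,
  Z = slC x + 'i%C *: slC y.
Proof.
move=> Z0; have [x xE] : exists x, vsval x = mxRe Z.
  by apply: sl_lift; rewrite /mxtrace; under eq_bigr do rewrite mxE;
    rewrite -Re_sum -/(mxtrace Z) Z0.
have [y yE] : exists x, vsval x = mxIm Z.
  by apply: sl_lift; rewrite /mxtrace; under eq_bigr do rewrite mxE;
    rewrite -Im_sum -/(mxtrace Z) Z0.
by exists x, y; rewrite /slC xE yE -mx_ReIm.
Qed.

Lemma slC_ReIm_inj x y x' y' :
  slC x + 'i%C *: slC y = slC x' + 'i%C *: slC y' -> x = x' /\ y = y'.
Proof.
move=> /matrixP e; split; apply: subvs_inj; apply/matrixP=> i j; have := e i j;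
  rewrite !mxE.
  by move/(congr1 (@complex.Re R));
    rewrite !Re_add /= !mul0r !mul1r !subr0 !addr0.
by move/(congr1 (@complex.Im R)); rewrite !Im_add /= !mul0r !mul1r !add0r.
Qed.

Lemma iter_lieb_ReIm x a b k :
  iter k (lieb (slC x)) (slC a + 'i%C *: slC b)
  = slC (iter k (lieb x) a) + 'i%C *: slC (iter k (lieb x) b).
Proof. by elim: k => //= k ->; rewrite liebDr liebZr !slCM. Qed.

Lemma cartan_regular_spectrum h x :
    cartan h -> x \in h ->
    (forall w k, iter k (lieb x) w = 0 -> w \in h) ->
  exists ds, simple_spectrum (vsval x) ds.
Proof.
move=> [[m hm] _] hx xP.
have [//|[a rk]] := geigenspace_dichotomy (slC x).
have [E [Z [k [[EZ nzZ] trE trZ kE kZ]]]] := geigenspace_sl2 rk.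
have inh X : \tr X = 0 -> iter k (lieb (slC x)) X = 0 ->
    exists u v, [/\ u \in h, v \in h & X = slC u + 'i%C *: slC v].
  move=> /sl_ReIm[u [v ->]]; rewrite iter_lieb_ReIm => e0.
  have [|u0 v0] := @slC_ReIm_inj (iter k (lieb x) u) (iter k (lieb x) v) 0 0.
    by rewrite e0 /slC linear0 /mxC map_mx0 scaler0 addr0.
  by exists u, v; split=> //; [apply: xP u0|apply: xP v0].
have [e1 [e2 [he1 he2 EE]]] := inh _ trE kE.
(* As Z = [E, Z], each bracket with E moves Z one term down the complexified lower central series,
   so Z lies in the last term, which is 0. *)
have inLC j : exists u v,
  [/\ u \in lower_central h j, v \in lower_central h j &
  Z = slC u + 'i%C *: slC v].
  elim: j => [|j [u [v [hu hv ZE]]]]; first exact: inh.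
  exists ([lie e1, u] - [lie e2, v]), ([lie e1, v] + [lie e2, u]).
  split; rewrite ?memvB ?memvD ?memv_lieprod //.
  rewrite -EZ EE {1}ZE liebDl !liebDr !liebZl !liebZr -!slCM /slC.
  rewrite linearB linearD /= mxCB mxCD !scalerDr scalerA.
  have -> : 'i%C * 'i%C = -1 :> C by rewrite -expr2 sqr_i.
  by rewrite scaleN1r [X in _ + X = _]addrC addrACA.
have [u [v []]] := inLC m; rewrite hm !memv0 => /eqP-> /eqP-> Z0.
by case/eqP: nzZ; rewrite Z0 /slC linear0 /mxC map_mx0 scaler0 addr0.
Qed.
End CartanSpectrum.

(** * Subspaces given by predicates and by coordinates *)

(** A subspace of maximal dimension inside P works: adjoining the line of another vector of P stays
    inside P, so it adds nothing. *)
Lemma vspace_comprehension (F : fieldType) (V : vectType F) (P : V -> Prop) :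
    P 0 -> (forall a x y, P x -> P y -> P (a *: x + y)) ->
  exists U : {vspace V}, forall x, x \in U <-> P x.
Proof.
move=> P0 PD.
have [|U _|U UP Umax] := @ex_max_measure _
  (fun U : {vspace V} => forall x, x \in U -> P x) (fun U => \dim U)
  (\dim {:V}).
- by exists 0%VS => x; rewrite memv0 => /eqP->.
- exact/dimvS/subvf.
exists U => x; split=> [|Px]; first exact: UP.
have dimUx : (\dim (U + <[x]>) <= \dim U)%N.
  apply: Umax => _ /memv_addP[u Uu [_ /vlineP[k ->] ->]].
  by rewrite addrC; apply: PD => //; apply: UP.
have /eqP-> : (U == U + <[x]>)%VS by rewrite eqEdim addvSl.
by apply: (subvP (addvSr _ _)); apply: memv_line.
Qed.

(** Preimages of the unit vectors form a basis. The [c i] are plain functions, which suits imaginary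
    parts of complex evaluations. *)
Lemma dim_coordinates (F : fieldType) (V : vectType F) (U : {vspace V}) p
  (c : 'I_p -> V -> F) :
    (forall i a x y, c i (a *: x + y) = a * c i x + c i y) ->
    (forall x, x \in U -> (forall i, c i x = 0) -> x = 0) ->
    (forall t : 'I_p -> F, exists2 x, x \in U & forall i, c i x = t i) ->
  \dim U = p.
Proof.
move=> clin cinj csurj.
have c0 i : c i 0 = 0.
  by have := clin i 1 0 0; rewrite scale1r addr0 mul1r => /esym/eqP;
    rewrite -subr_eq0 addrK => /eqP.
have csum i (I : Type) (r : seq I) (k : I -> F) (x : I -> V) :
    c i (\sum_(j <- r) k j *: x j) = \sum_(j <- r) k j * c i (x j).
  by elim: r => [|j r IH]; rewrite ?big_nil // !big_cons clin IH.
have /choice[e eP] : forall i : 'I_p, exists x, x \in U /\ forall j,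
  c j x = (i == j)%:R.
  by move=> i; have [x Ux cx] := csurj (fun j => (i == j)%:R); exists x.
have ce i (k : 'I_p -> F) : c i (\sum_j k j *: e j) = k i.
  rewrite csum (bigD1 i) //= big1 => [|j nji]; rewrite (eP _).2; last
    by rewrite (negPf nji) mulr0.
  by rewrite eqxx mulr1 addr0.
suff : basis_of U [tuple e i | i < p] by move/size_basis.
have nthe (i : 'I_p) : [tuple e i | i < p]`_i = e i
  by rewrite -tnth_nth tnth_mktuple.
apply/andP; split; last first.
  apply/freeP => k k0 i; rewrite -(ce i k) -[RHS](c0 i); congr (c i _).
  by rewrite -[RHS]k0; apply: eq_bigr => j _; rewrite nthe.
rewrite eqEsubv; apply/andP; split.
  by apply/span_subvP=> _ /mapP[i _ ->]; apply: (eP i).1.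
apply/subvP=> x Ux; suff -> : x = \sum_i c i x *: e i.
  apply: memv_suml => i _; rewrite memvZ //; apply: memv_span.
  by rewrite -nthe mem_nth ?size_tuple.
apply/eqP; rewrite -subr_eq0; apply/eqP/cinj.
  by rewrite memvB // memv_suml // => i _; rewrite memvZ ?(eP i).1.
by move=> i; rewrite -scaleN1r addrC clin ce mulN1r addNr.
Qed.

(** * The subalgebra R I + h *)

Section Bsub.
Variables (F : numFieldType) (n : nat).
Implicit Types (h : {liesub sl F n.+1}) (x : sl F n.+1).

Lemma BsubP h A :
  A \in Bsub h <-> exists c, exists2 x, x \in h & A = c%:M + vsval x.
Proof.
split=> [/memv_addP[_ /vlineP[c ->] [_ /memv_imgP[x hx ->] ->]]|[c [x hx ->]]].
  by exists c, x => //; rewrite lfunE scalemx1.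
rewrite -scalemx1 memv_add ?memvZ ?memv_line //.
by apply/memv_imgP; exists x; rewrite ?lfunE.
Qed.

Lemma vsval_Bsub h x : (vsval x \in Bsub h) = (x \in h).
Proof.
apply/idP/idP=> [/BsubP[c [y hy e]]|hx]; last first.
  by apply/BsubP; exists 0, x => //; rewrite raddf0 add0r.
suff c0 : c = 0.
  by have -> : x = y by apply: subvs_inj; rewrite e c0 raddf0 add0r.
have := congr1 mxtrace e; rewrite linearD /=
  !sl_tr0 mxtrace_scalar addr0 => /esym/eqP.
by rewrite -mulr_natr mulf_eq0 pnatr_eq0 orbF => /eqP.
Qed.

Lemma Bsub_decomp (A : 'M[F]_n.+1) : exists c x, A = c%:M + vsval x.
Proof.
have [|x xE] := @sl_lift _ _ (A - (\tr A / n.+1%:R)%:M).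
  by rewrite linearB /= mxtrace_scalar -[_ *+ _]mulr_natr divfK ?subrr
    ?pnatr_eq0.
by exists (\tr A / n.+1%:R), x; rewrite xE addrC subrK.
Qed.

Lemma dim_Bsub h : \dim (Bsub h) = (\dim h).+1.
Proof.
rewrite dimv_disjoint_sum.
  rewrite dim_vline -[RHS]add1n; congr (_ + _)%N; first by rewrite oner_eq0.
  apply: limg_dim_eq; apply/eqP; rewrite -subv0; apply/subvP=> x.
  rewrite memv_cap memv_ker lfunE memv0 => /andP[_ /eqP x0].
  by apply/eqP/subvs_inj; rewrite x0 linear0.
apply/eqP; rewrite -subv0; apply/subvP=> A; rewrite memv_cap memv0.
case/andP=> /vlineP[c ->] /memv_imgP[x _]; rewrite lfunE /= => e.
have := congr1 mxtrace e; rewrite sl_tr0 linearZ /= mxtrace1 => /eqP.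
by rewrite mulf_eq0 pnatr_eq0 orbF => /eqP->; rewrite scale0r.
Qed.

End Bsub.

(** * Counting eigenvalues, and the dimension of R[M] *)

Section SpectrumCounting.
Variables (R : realType) (n : nat).
Local Notation C := R[i].
Local Notation toC := (real_complex R).
Local Notation polyC_of := (map_poly toC).
Local Notation L := (sl R n.+1).

(* One nonreal eigenvalue out of each conjugate pair. *)
Definition upper (ds : seq C) := [seq z <- ds | 0 < complex.Im z].
Definition reals (ds : seq C) := [seq z <- ds | complex.Im z == 0].

(** Conjugation matches the eigenvalues below the real axis with those above it. *)
Lemma simple_spectrum_size (M : 'M[R]_n.+1) ds : simple_spectrum M ds ->
  (2 * size (upper ds) + size (reals ds))%N = n.+1.
Proof.
move=> Mds; have [us sz _] := Mds.
have lower : size [seq z <- ds | complex.Im z < 0] = size (upper ds).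
  rewrite -(size_map conjc (upper ds)); apply: perm_size; apply: uniq_perm.
  - by rewrite filter_uniq.
  - by rewrite map_inj_uniq ?filter_uniq //; apply: can_inj (@conjcK R).
  move=> z; rewrite mem_filter; apply/andP/mapP => [[im dz]|[w]].
    exists (conjc z); last by rewrite conjcK.
    by rewrite mem_filter Im_conjc oppr_gt0 im (simple_conj Mds).
  rewrite mem_filter => /andP[im dw] ->.
  by rewrite Im_conjc oppr_lt0 im (simple_conj Mds).
rewrite -[RHS]sz -(count_predC (fun z => complex.Im z == 0) ds) -size_filter.
rewrite addnC -/(reals ds); congr (_ + _)%N.
rewrite mul2n -addnn -{2}lower /upper !size_filter -count_predUI.
rewrite (eq_count (a1 := predI _ _) (a2 := pred0)) ?count_pred0 ?addn0;
  last first.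
  by move=> z /=; case: ltgtP.
by apply: eq_count => z /=; case: ltgtP.
Qed.

(** The size equation turns the nonreal and the real eigenvalues, concatenated, into n.+1 distinct
    ones; [simple_spectrum_size] then halves the nonreal count. *)
Lemma simple_spectrum_distinct (M : 'M[R]_n.+1) p q :
  (distinct_eigenvalues M (2 * p) q /\ (2 * p + q = n.+1)%N) <->
  exists ds, [/\ simple_spectrum M ds, size (upper ds) = p &
    size (reals ds) = q].
Proof.
split=> [[[[s1 [u1 e1 sz1]] [s2 [u2 e2 sz2]]] sz]|[ds [Mds szp szq]]];
  last first.
  have szn := simple_spectrum_size Mds.
  split; last by rewrite -szp -szq.
  split.
    exists [seq z <- ds | complex.Im z != 0]; split.
    - by rewrite filter_uniq //; case: Mds.
    - by move=> z; rewrite mem_filter !inE (simple_eigenvalueC Mds) andbC.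
    - have [_ szd _] := Mds; move: szn;
        rewrite -szp -szd -(count_predC (fun z => complex.Im z == 0) ds)
        !size_filter.
      by rewrite addnC => /addnI.
  exists (reals ds); split=> //.
  - by rewrite filter_uniq //; case: Mds.
  - by move=> z; rewrite mem_filter !inE (simple_eigenvalueC Mds) andbC.
pose ds := s1 ++ s2.
have Mds : simple_spectrum M ds.
  split.
  - rewrite cat_uniq u1 u2 andbT /=; apply/hasPn=> z;
      rewrite e2 !inE => /andP[_ im0].
    by rewrite e1 !inE im0 andbF.
  - by rewrite size_cat sz1 sz2.
  - by move=> z; rewrite mem_cat e1 e2 !inE -andb_orr => /andP[].
exists ds; suff szq : size (reals ds) = q.
  by split=> //; have := simple_spectrum_size Mds; rewrite szq; lia.
rewrite -sz2; apply: perm_size; apply: uniq_perm => //.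
  by rewrite filter_uniq //; case: Mds.
move=> z; rewrite mem_filter mem_cat e1 e2 !inE.
by case: (complex.Im z == 0); rewrite ?andbF ?andbT ?orbF.
Qed.

(** Every eigenvalue is a root of the minimal polynomial, so the characteristic polynomial, a
    product of distinct linear factors, divides it. *)
Lemma simple_nonderogatory (M : 'M[R]_n.+1) ds :
  simple_spectrum M ds -> nonderogatory M.
Proof.
move=> Mds; have [us _ _] := Mds; apply/eqP.
rewrite -eqp_monic ?char_poly_monic ?mxminpoly_monic // /eqp mxminpoly_dvd_char
  andbT.
rewrite -(dvdp_map toC) (simple_char_poly Mds); apply: uniq_roots_dvdp; last
  by rewrite uniq_rootsE.
apply/allP=> z dz;
  rewrite -mxminpoly_map root_mxminpoly -map_char_poly -eigenvalueC_root.
by rewrite (simple_eigenvalueC Mds).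
Qed.

(** The powers of M below n.+1 form a basis: a relation between them would be a polynomial of degree
    at most n with n.+1 roots, and reduction modulo the characteristic polynomial reaches all of
    R[M]. *)
Lemma dim_in_polynomials (M : 'M[R]_n.+1) ds (V : {vspace 'M[R]_n.+1}) :
    simple_spectrum M ds -> (forall A, A \in V <-> in_polynomials M A) ->
  \dim V = n.+1.
Proof.
move=> Mds VP; have [us sz _] := Mds.
have hornerE k : horner_mx M (\poly_(i < n.+1) k i) =
  \sum_(i < n.+1) k i *: M ^+ i.
  rewrite poly_def linear_sum; apply: eq_bigr => i _.
  by rewrite linearZ /= rmorphXn /= horner_mx_X.
suff : basis_of V [tuple M ^+ i | i < n.+1] by move/size_basis.
have nthe (i : 'I_n.+1) : [tuple M ^+ i | i < n.+1]`_i = M ^+ i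
  by rewrite -tnth_nth tnth_mktuple.
apply/andP; split; last first.
  apply/freeP=> k k0 i; pose k' j := k (inord j).
  have kE : \sum_(i < n.+1) k' i *: M ^+ i = 0.
    by rewrite -[RHS]k0; apply: eq_bigr => j _; rewrite nthe /k' inord_val.
  have : \poly_(i < n.+1) k' i = 0.
    apply/eqP; rewrite -(map_poly_eq0 toC); apply: contraT => nz.
    have := max_poly_roots nz (_ : all _ ds) us.
    rewrite sz size_map_poly ltnNge size_poly; apply; apply/allP=> z dz.
    have [U [U0 UM _]] := simple_eigenvectors Mds.
    apply/rootP; rewrite -(ev_horner U0 UM) // hornerE kE.
    by rewrite /ev /mxC map_mx0 mulmx0 mul0mx mxE.
  by move/polyP/(_ i); rewrite coef_poly ltn_ord coef0 /k' inord_val.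
rewrite eqEsubv; apply/andP; split.
  apply/span_subvP=> _ /mapP[i _ ->]; apply/VP; exists ('X ^+ i).
  by rewrite rmorphXn /= horner_mx_X.
apply/subvP=> _ /VP[P ->].
pose r := P %% char_poly M.
have -> : horner_mx M P = horner_mx M r.
  rewrite {1}(divp_eq P (char_poly M)) rmorphD rmorphM /=
    [horner_mx M (char_poly M)]Cayley_Hamilton.
  by rewrite mulr0 add0r.
have szr : (size r <= n.+1)%N.
  by rewrite -ltnS -(size_char_poly M) ltn_modp monic_neq0 ?char_poly_monic.
have -> : r = \poly_(i < n.+1) r`_i.
  apply/polyP=> i; rewrite coef_poly; case: ltnP => // le.
  by rewrite nth_default // (leq_trans szr).
rewrite hornerE; apply: memv_suml => i _; rewrite memvZ //; apply: memv_span.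
by rewrite -nthe mem_nth ?size_tuple.
Qed.

End SpectrumCounting.

(** * Cartan subalgebras as polynomials in a matrix, and the spectrum of ad *)

Section CartanPolynomials.
Variables (R : realType) (n : nat).
Local Notation C := R[i].
Local Notation toC := (real_complex R).
Local Notation polyC_of := (map_poly toC).
Local Notation L := (sl R n.+1).
Implicit Types (h : {liesub L}) (M : 'M[R]_n.+1).

Definition Bsub_polynomials h M := forall A, A \in Bsub h <->
  in_polynomials M A.

Lemma lieb_horner_mx M P Q : [lie horner_mx M P, horner_mx M Q] = 0.
Proof.
apply/eqP; rewrite mx_liebE subr_eq0 -[_ *m _]rmorphM -[X in _ == X]rmorphM.
by rewrite mulrC.
Qed.

Lemma Bsub_polynomials_h h M x :
  Bsub_polynomials h M -> x \in h <-> in_polynomials M (vsval x).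
Proof. by move=> hM; rewrite -vsval_Bsub. Qed.

Lemma Bsub_polynomials_abelian h M x y :
  Bsub_polynomials h M -> x \in h -> y \in h -> [lie x, y] = 0.
Proof.
move=> hM /(Bsub_polynomials_h _ hM)[P xE] /(Bsub_polynomials_h _ hM)[Q yE].
by apply: subvs_inj; rewrite vsval_lieb xE yE lieb_horner_mx linear0.
Qed.

(** h is abelian. If x normalizes h, then [M, x] lies in h and commutes with M, so [M, x] = 0
    because ad M is diagonalizable, and the commutant of M is R[M]. *)
Lemma Bsub_polynomials_cartan h M ds :
  simple_spectrum M ds -> Bsub_polynomials h M -> cartan h.
Proof.
move=> Mds hM; split.
  exists 1%N; apply/eqP; rewrite -subv0; apply/lieprodvP=> x y hx hy.
  by rewrite (Bsub_polynomials_abelian hM) ?mem0v.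
move=> x; split=> [nx|hx y hy]; last exact: memv_lieb.
have [c [y ME]] := Bsub_decomp M.
have hy : y \in h.
  rewrite -vsval_Bsub; have -> : vsval y = M - c%:M by rewrite ME addrC addKr.
  by apply/hM; exists ('X - c%:P); rewrite rmorphB /= horner_mx_X horner_mx_C.
have Mx : [lie M, vsval x] = - vsval [lie x, y].
  rewrite vsval_lieb -lieb_anti {1}ME !mx_liebE mulmxDl mulmxDr.
  by rewrite mul_scalar_mx mul_mx_scalar opprD addrACA subrr add0r.
apply/(Bsub_polynomials_h _ hM)/(simple_commutant Mds)/(simple_double_commutant
  Mds).
have /(Bsub_polynomials_h _ hM)[P e] : - [lie x, y] \in h by rewrite memvN nx.
rewrite Mx; have -> : - vsval [lie x, y] = horner_mx M P by rewrite -e linearN.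
by rewrite -[X in [lie X, _]]horner_mx_X lieb_horner_mx.
Qed.

(** What commutes with x lies in its null space, hence in h. Conversely some power of ad x kills
    each y in h by nilpotency, and [simple_double_commutant] brings the power down to 1. *)
Lemma cartan_Bsub_polynomials h x ds :
    cartan h -> x \in h -> (forall w k, iter k (lieb x) w = 0 -> w \in h) ->
    simple_spectrum (vsval x) ds ->
  Bsub_polynomials h (vsval x).
Proof.
move=> [[m hm] _] hx xP Mds A; have [c [y AE]] := Bsub_decomp A.
have lieb1 : [lie vsval x, A] = vsval [lie x, y].
  rewrite vsval_lieb AE !mx_liebE mulmxDl mulmxDr.
  by rewrite mul_scalar_mx mul_mx_scalar opprD addrACA subrr add0r.
split=> [hA|[P AP]]; last first.
  apply/BsubP; exists c, y => //; apply: (xP y 1%N); apply: subvs_inj => /=.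
  by rewrite -lieb1 AP -[X in [lie X, _]]horner_mx_X lieb_horner_mx.
have hy : y \in h.
  rewrite -vsval_Bsub; have -> : vsval y = A - c%:M by rewrite AE addrC addKr.
  rewrite memvB //; apply/BsubP; exists c, 0; rewrite ?mem0v //.
  by rewrite linear0 addr0.
suff y0 : [lie x, y] = 0.
  by apply: (simple_commutant Mds); rewrite lieb1 y0 linear0.
have : iter m (lieb x) y = 0.
  by apply/eqP; rewrite -memv0 -hm iter_lower_central.
elim: m {hm} => [/= ->|[//|m] IH]; first by rewrite linear0.
move=> e0; apply: IH; rewrite iterS; apply: subvs_inj; rewrite linear0.
move: e0; rewrite 2!iterS => /(congr1 vsval); rewrite linear0 !vsval_lieb.
exact: (simple_double_commutant Mds).
Qed.

(** The eigenvalues are defined through the matrix of ad x in a real basis. The map [g] identifies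
    complex coordinate rows with traceless complex matrices and turns that matrix into the bracket
    with x. *)
Lemma lfun_eigenvalueC_ad (x : L) z :
  lfun_eigenvalueC (ad x) z <->
  exists Z : 'M[C]_n.+1, [/\ Z != 0, \tr Z = 0 & [lie slC x, Z] = z *: Z].
Proof.
have basisL := vbasisP {:L}; set e := vbasis {:L} in basisL *.
pose g (v : 'rV[C]__) := slC (passmx.vecof e (mxRe v)) + 'i%C *: slC
  (passmx.vecof e (mxIm v)).
have gE v : g v = \sum_i v 0 i *: slC e`_i.
  rewrite /g !(big_morph _ (@slCD R n) (@slC0 R n)) scaler_sumr -big_split /=.
  apply: eq_bigr => i _; rewrite !slCZ scalerA -scalerDl !mxE.
  by rewrite [in RHS](complexE (v 0 i)).
have gZ k v : g (k *: v) = k *: g v.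
  by rewrite !gE scaler_sumr; apply: eq_bigr => i _; rewrite mxE scalerA.
have gB v w : g (v - w) = g v - g w.
  by rewrite !gE -sumrB; apply: eq_bigr => i _; rewrite !mxE scalerBl.
have gM v : g (v *m mxC (passmx.mxof e e (ad x))) = [lie slC x, g v].
  rewrite /g mxReMr mxImMr liebDr liebZr -!slCM.
  by rewrite -!adE !passmx.mul_mxof !passmx.rVofK.
have g0 v : g v = 0 -> v = 0.
  move=> gv; have [|v1 v2] := @slC_ReIm_inj _ _ (passmx.vecof e (mxRe v))
    (passmx.vecof e (mxIm v)) 0 0.
    by rewrite -/(g v) gv /slC linear0 /mxC map_mx0 scaler0 addr0.
  by apply: mxReImP; apply/eqP; rewrite -(passmx.vecof_eq0 basisL) ?v1 ?v2.
have gtr v : \tr (g v) = 0.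
  have tr0 u : \tr (slC u) = 0 by rewrite /slC /mxC trace_map_mx sl_tr0 rmorph0.
  by rewrite /g linearD linearZ /= !tr0 mulr0 addr0.
have gsurj Z : \tr Z = 0 -> exists v, g v = Z.
  move=> /sl_ReIm[a [b ->]].
  exists (mxC (passmx.rVof e a) + 'i%C *: mxC (passmx.rVof e b)).
  rewrite /g; congr (slC _ + _ *: slC _).
    rewrite -[RHS](passmx.rVofK basisL); congr passmx.vecof; apply/rowP=> i.
    by rewrite !mxE !Re_add /= !mul0r !mul1r !subr0 addr0.
  rewrite -[RHS](passmx.rVofK basisL); congr passmx.vecof; apply/rowP=> i.
  by rewrite !mxE !Im_add /= !mul0r !mul1r !add0r.
split=> [/eigenvalueP[v vE nzv]|[Z [nzZ /gsurj[v ZE] gv]]].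
  exists (g v); split=> //; first by apply: contra nzv => /eqP/g0->.
  by rewrite -gM -gZ -vE.
have gv0 : g 0 = 0 by rewrite -[0 in LHS](scale0r 0) gZ scale0r.
apply/eigenvalueP; exists v; last first.
  by apply: contraNneq nzZ => v0; rewrite -ZE v0 gv0.
by apply/eqP; rewrite -subr_eq0; apply/eqP/g0; rewrite gB gZ gM ZE gv subrr.
Qed.

(** In the eigenbasis ad x scales the entry (i, j) by a difference of values of P; any nonzero entry
    of an eigenvector yields a and b. *)
Lemma ad_eigenvalue_sub M ds (x : L) (P : {poly R}) z :
    simple_spectrum M ds -> vsval x = horner_mx M P ->
      lfun_eigenvalueC (ad x) z ->
  exists a b, [/\ a \in ds, b \in ds & z = (polyC_of P).[a] - (polyC_of P).[b]].
Proof.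
move=> Mds xE /lfun_eigenvalueC_ad[Z [nzZ _ xZ]].
have [U [U0 UM _]] := simple_eigenvectors Mds.
pose d := \row_(i < n.+1) (polyC_of P).[ds`_i].
have TE i j : (d 0 i - d 0 j) * to_eigen ds U Z i j = z * to_eigen ds U Z i j.
  rewrite -mul_diag_commE -(to_eigen_horner Mds U0 UM) -!(to_eigenM Mds U0 UM)
    -to_eigenB.
  by rewrite -xE -mx_liebE xZ to_eigenZ mxE.
have [i [j nzij]] : exists i j, to_eigen ds U Z i j != 0.
  apply: contra_notP (elimN eqP nzZ) => all0; apply: (to_eigen_inj Mds U0 UM).
  rewrite /to_eigen mulmx0 mul0mx; apply/matrixP=> i j; rewrite [RHS]mxE.
  by apply/eqP/negPn/negP => nz; apply: all0; exists i, j.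
exists ds`_i, ds`_j; split; rewrite ?(nth_simple Mds) //.
by have := mulIf nzij (TE i j); rewrite !mxE => <-.
Qed.

(** The eigenvector is a matrix unit of the eigenbasis; a != b puts it off the diagonal, which makes
    it traceless. *)
Lemma sub_ad_eigenvalue M ds (x : L) (P : {poly R}) a b :
    simple_spectrum M ds -> vsval x = horner_mx M P ->
    a \in ds -> b \in ds -> a != b ->
  lfun_eigenvalueC (ad x) ((polyC_of P).[a] - (polyC_of P).[b]).
Proof.
move=> Mds xE da db nab.
have [us sz _] := Mds; have [U [U0 UM _]] := simple_eigenvectors Mds.
have uS := eigen_mx_unit Mds U0 UM.
have ia : (index a ds < n.+1)%N by rewrite -sz index_mem.
have ib : (index b ds < n.+1)%N by rewrite -sz index_mem.
pose i := Ordinal ia; pose j := Ordinal ib.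
have nij : i != j.
  apply: contra nab => /eqP/(congr1 val)/= e.
  by rewrite -(nth_index 0 da) e nth_index.
have [Z TZ] : exists Z, to_eigen ds U Z = delta_mx i j.
  exists (invmx (eigen_mx ds U) *m delta_mx i j *m eigen_mx ds U).
  by rewrite /to_eigen !mulmxA mulmxV // mul1mx mulmxK.
apply/lfun_eigenvalueC_ad; exists Z; split.
- apply: contraTneq isT => Z0; have /matrixP/(_ i j) := TZ.
  rewrite Z0 /to_eigen mulmx0 mul0mx !mxE !eqxx => /esym/eqP.
  by rewrite oner_eq0.
- rewrite -(to_eigen_tr Mds U0 UM) TZ /mxtrace (bigD1 i) //= big1 => [|k nki].
    by rewrite mxE (negPf nij) andbF addr0.
  by rewrite mxE (negPf nki).
apply: (to_eigen_inj Mds U0 UM);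
  rewrite to_eigenZ TZ mx_liebE to_eigenB !(to_eigenM Mds U0 UM) TZ.
rewrite /slC xE (to_eigen_horner Mds U0 UM); apply/matrixP=> k l.
rewrite mul_diag_commE !mxE; case: (k =P i) => [->|_]; last by rewrite !mulr0.
by case: (l =P j) => [->|_]; rewrite ?mulr0 //= !nth_index.
Qed.

End CartanPolynomials.

(** * Toroidal and vector parts *)

Section Splitting.
Variables (R : realType) (n : nat).
Local Notation C := R[i].
Local Notation toC := (real_complex R).
Local Notation polyC_of := (map_poly toC).
Local Notation L := (sl R n.+1).
Implicit Types (h : {liesub L}) (M : 'M[R]_n.+1).

Lemma ad_imaginaryP M ds (x : L) P :
    simple_spectrum M ds -> vsval x = horner_mx M P ->
  {in lfun_eigenvalueC (ad x), forall z, complex.Re z = 0} <->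
  {in ds, forall a, complex.Re (polyC_of P).[a] = 0}.
Proof.
move=> Mds xE; split=> re0; last first.
  by move=> z /(ad_eigenvalue_sub Mds xE)[a [b [da db ->]]];
    rewrite Re_sub !re0 // subrr.
move=> a da; have [us sz _] := Mds.
have eqa b : b \in ds -> complex.Re (polyC_of P).[b] =
  complex.Re (polyC_of P).[a].
  move=> db; have [->//|nab] := eqVneq b a.
  by apply/eqP; rewrite -subr_eq0 -Re_sub;
    apply/eqP/re0/(sub_ad_eigenvalue Mds xE).
have := congr1 (@complex.Re R) (simple_horner_tr Mds P).
rewrite -xE sl_tr0 /= Re_sum big_seq (eq_bigr _ eqa) -big_seq.
rewrite big_const_seq count_predT sz iter_addr_0 => /esym/eqP.
by rewrite mulrn_eq0 /= => /eqP.
Qed.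

(** Conjugation does here what the trace does in the imaginary case: for nonreal a, P(a) - P(conj a)
    = 2 i Im P(a) is itself an eigenvalue of ad x. *)
Lemma ad_realP M ds (x : L) P :
    simple_spectrum M ds -> vsval x = horner_mx M P ->
  {in lfun_eigenvalueC (ad x), forall z, complex.Im z = 0} <->
  {in ds, forall a, complex.Im (polyC_of P).[a] = 0}.
Proof.
move=> Mds xE; split=> im0; last first.
  by move=> z /(ad_eigenvalue_sub Mds xE)[a [b [da db ->]]];
    rewrite Im_sub !im0 // subrr.
move=> a da; have dJ := simple_conj Mds da.
have PJ : (polyC_of P).[conjc a] = conjc (polyC_of P).[a]
  by exact: horner_real_conj.
have e : complex.Im (polyC_of P).[a] - complex.Im (polyC_of P).[conjc a] = 0.
  have [<-|nab] := eqVneq a (conjc a); first by rewrite subrr.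
  by rewrite -Im_sub; apply/im0/(sub_ad_eigenvalue Mds xE).
by move: e; rewrite PJ Im_conjc; lra.
Qed.

Lemma horner_mx_simple_val M ds P Q : simple_spectrum M ds ->
    horner_mx M P = horner_mx M Q ->
  {in ds, forall a, (polyC_of P).[a] = (polyC_of Q).[a]}.
Proof.
move=> Mds PQ a da; have [U [U0 UM _]] := simple_eigenvectors Mds.
by rewrite -!(ev_horner U0 UM) // PQ.
Qed.

(** The real part as [l] cuts out the toroidal part, the imaginary part the vector part. The
    condition is the same for every P representing x, since x determines the values of P on [ds]. *)
Lemma spectral_liesub h M ds (l : C -> R) :
    simple_spectrum M ds -> Bsub_polynomials h M ->
    (forall (k : R) a b, l (toC k * a + b) = k * l a + l b) ->
  exists hl : {liesub L}, (hl <= h)%VS /\ forall x P, vsval x = horner_mx M P ->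
    x \in hl <-> {in ds, forall a, l (polyC_of P).[a] = 0}.
Proof.
move=> Mds hM llin.
have l0 : l 0 = 0.
  by have := llin 1 0 0; rewrite mulr0 addr0 mul1r => /esym/eqP;
    rewrite -subr_eq0 addrK => /eqP.
have [|k x y [P xP lP] [Q yQ lQ]|V VP] := @vspace_comprehension _ L
  (fun x => exists2 P, vsval x = horner_mx M P &
    {in ds, forall a, l (polyC_of P).[a] = 0}).
- by exists 0 => [|a _]; rewrite ?linear0 ?rmorph0 ?horner0.
- exists (k *: P + Q); first by rewrite !linearD !linearZ /= xP yQ.
  move=> a da; rewrite rmorphD /= -mul_polyC rmorphM /= map_polyC /=
    hornerD hornerM hornerC.
  by rewrite llin lP // lQ // mulr0 addr0.
have Vh : (V <= h)%VS.
  by apply/subvP=> x /VP[P xP _]; apply/(Bsub_polynomials_h _ hM); exists P.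
have Vlie : (lieprodv V V <= V)%VS.
  apply/lieprodvP=> x y /(subvP Vh) hx /(subvP Vh) hy.
  by rewrite (Bsub_polynomials_abelian hM) ?mem0v.
exists (LieSub Vlie); split=> // x P xP; split=> [/VP[Q xQ lQ] a da|lP].
  by rewrite (horner_mx_simple_val Mds _ da (Q := Q)) ?lQ // -xP.
by apply/VP; exists P.
Qed.

(** The last two clauses state that both parts are the largest possible, which allows comparison
    with any other splitting of h. *)
Lemma spectral_splitting h M ds :
    simple_spectrum M ds -> Bsub_polynomials h M ->
  exists hp hm : {liesub L},
    [/\ toroidal_vector_split h hp hm,
        \dim hp = size (upper ds),
        (\dim hm + 1 = size (upper ds) + size (reals ds))%N,
        forall x, x \in h ->
          {in lfun_eigenvalueC (ad x), forall z, complex.Re z = 0} -> x \in hp &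
        forall x, x \in h ->
          {in lfun_eigenvalueC (ad x), forall z, complex.Im z = 0} -> x \in hm].
Proof.
move=> Mds hM; have [us sz _] := Mds.
have [hp [hph hpP]] := spectral_liesub Mds hM (@Re_linear R).
have [hm [hmh hmP]] := spectral_liesub Mds hM (@Im_linear R).
have sub_poly (V : {liesub L}) x : (V <= h)%VS -> x \in V ->
  in_polynomials M (vsval x).
  by move=> /subvP Vh /Vh/(Bsub_polynomials_h _ hM).
have cap0 : (hp :&: hm)%VS = 0%VS.
  apply/eqP; rewrite -subv0; apply/subvP=> x;
    rewrite memv_cap memv0 => /andP[px mx].
  have [P xP] := sub_poly _ _ hph px.
  apply/eqP/subvs_inj; rewrite linear0 xP;
    apply: (horner_mx_simple_eq0 Mds) => a da.
  by apply: complexP; [exact: ((hpP _ _ xP).1 px) | exact: ((hmP _ _ xP).1 mx)].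
have split_sum : (hp + hm)%VS = h :> {vspace L}.
  apply/eqP; rewrite eqEsubv subv_add hph hmh /=; apply/subvP=> x hx.
  have [P xP] := (Bsub_polynomials_h _ hM).1 hx.
  (* The vector component of x interpolates the real parts of the values of P. It is traceless
     because those values sum to the trace of x; the remainder has imaginary values. *)
  have [|Q QE] := real_interpolation
    (f := fun a => toC (complex.Re (polyC_of P).[a])) us (simple_conj Mds).
    by move=> a da; rewrite horner_real_conj Re_conjc conjc_real.
  have [|y yQ] := @sl_lift _ n (horner_mx M Q).
    have := simple_horner_tr Mds Q; rewrite big_seq (eq_bigr _ QE) -big_seq.
    rewrite -(raddf_sum toC) -Re_sum -(simple_horner_tr Mds) -xP sl_tr0 /=.
    by case.
  have my : y \in hm by apply/(hmP _ _ yQ) => a da; rewrite QE.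
  rewrite -[x](subrK y) memv_add //; apply/(hpP _ (P - Q)).
    by rewrite !linearB /= xP yQ.
  by move=> a da; rewrite rmorphB hornerD hornerN QE // Re_sub /= subrr.
have dimhp : \dim hp = size (upper ds).
  have [U [U0 UM _]] := simple_eigenvectors Mds.
  have upP (i : 'I_(size (upper ds))) :
    (upper ds)`_i \in ds /\ 0 < complex.Im (upper ds)`_i.
    have : (upper ds)`_i \in upper ds by rewrite mem_nth.
    by rewrite mem_filter => /andP[].
  (* The coordinates are the imaginary parts at the upper eigenvalues: those at the lower ones
     follow by conjugation, those at the real ones vanish. *)
  apply: (dim_coordinates
    (c := fun i (x : L) => complex.Im (ev U (upper ds)`_i (vsval x)))).
  - move=> i a x y; rewrite linearD linearZ /= ev_linear Im_add mulrC;
      congr (_ + _).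
    by rewrite Im_mulr_real mulrC.
  - move=> x px im0; have [P xP] := sub_poly _ _ hph px.
    apply/subvs_inj; rewrite linear0 xP; apply: (horner_mx_simple_eq0 Mds).
    have upP0 a : a \in ds -> 0 < complex.Im a -> (polyC_of P).[a] = 0.
      move=> da ima; have ua : a \in upper ds by rewrite mem_filter ima.
      have ia : (index a (upper ds) < size (upper ds))%N by rewrite index_mem.
      have := im0 (Ordinal ia);
        rewrite /= nth_index // xP (ev_horner U0 UM) // => im.
      by apply: complexP => //; apply: ((hpP _ _ xP).1 px).
    move=> a da; have [im|im|im] := ltgtP 0 (complex.Im a).
    + exact: upP0.
    + have := upP0 _ (simple_conj Mds da); rewrite Im_conjc oppr_gt0 => /(_ im).
      by rewrite horner_real_conj => /eqP; rewrite conjc_eq0 => /eqP.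
    + apply: complexP; first exact: ((hpP _ _ xP).1 px).
      have := horner_real_conj P a; have /eqP<- : a == conjc a
        by rewrite conjcP im.
      by move/(congr1 (@complex.Im R)); rewrite Im_conjc /=; lra.
  (* [t'] places the prescribed coordinates at the upper eigenvalues, with default 0; [f] extends
     them to a purely imaginary function compatible with conjugation. *)
  move=> t; pose t' a := if insub (index a (upper ds)) is Some i then t i else
    0.
  have t'E (i : 'I_(size (upper ds))) : t' (upper ds)`_i = t i.
    by rewrite /t' index_uniq ?filter_uniq // valK.
  pose f a := if 0 < complex.Im a then 'i%C * toC (t' a) else
     if complex.Im a < 0 then - ('i%C * toC (t' (conjc a))) else 0.
  have [a _|P PE] := real_interpolation (f := f) us (simple_conj Mds).
    rewrite /f Im_conjc oppr_gt0 oppr_lt0 conjcK.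
    by case: ltgtP => _; apply: complexP => /=; ring.
  have Ref a : complex.Re (f a) = 0.
    by rewrite /f; do 2?case: ifP => _; rewrite //=; ring.
  have [|x xP] := @sl_lift _ n (horner_mx M P).
    have := congr1 (@complex.Re R) (simple_horner_tr Mds P).
    by rewrite Re_sum big_seq big1 // => a da; rewrite PE.
  exists x; first by apply/(hpP _ _ xP) => a da; rewrite PE.
  move=> i; have [dup imup] := upP i.
  by rewrite xP (ev_horner U0 UM) // PE // /f imup t'E /=; ring.
exists hp, hm; split=> //.
- split=> // x xV.
    have [P xP] := sub_poly _ _ hph xV.
    by apply/(ad_imaginaryP Mds xP)/(hpP _ _ xP).
  have [P xP] := sub_poly _ _ hmh xV.
  by apply/(ad_realP Mds xP)/(hmP _ _ xP).
(* The two parts and the line of scalars add up to R[M], of dimension 2 * size upper + size reals;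
   the scalars account for the 1. *)
- have := dimv_disjoint_sum cap0; rewrite split_sum dimhp.
  have := dim_Bsub h; rewrite (dim_in_polynomials Mds hM).
  move=> [nE] hE; apply: (@addnI (size (upper ds))).
  by rewrite addnA -hE -nE addn1 -(simple_spectrum_size Mds) mul2n -addnn addnA.
- move=> x hx ad0; have [P xP] := (Bsub_polynomials_h _ hM).1 hx.
  by apply/(hpP _ _ xP)/(ad_imaginaryP Mds xP).
- move=> x hx ad0; have [P xP] := (Bsub_polynomials_h _ hM).1 hx.
  by apply/(hmP _ _ xP)/(ad_realP Mds xP).
Qed.

(** A given splitting is contained, part by part, in the maximal one built from a regular element;
    both have total dimension \dim h, so the dimensions agree. *)
Theorem cartan_iff_polynomials h p q :
  (cartan h /\ exists hp hm : {liesub L},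
      [/\ toroidal_vector_split h hp hm, \dim hp = p &
        (\dim hm + 1 = p + q)%N]) <->
  exists M ds, [/\ simple_spectrum M ds, Bsub_polynomials h M,
     size (upper ds) = p & size (reals ds) = q].
Proof.
split=> [[ch [hp [hm [[sum cap hpP hmP] dp dq]]]]|[M [ds [Mds hM szp szq]]]].
  have [x hx xP] := cartan_regular ch.
  have [ds Mds] := cartan_regular_spectrum ch hx xP.
  have hM := cartan_Bsub_polynomials ch hx xP Mds.
  have [hp' [hm' [[sum' cap' _ _] dp' dq' hpM hmM]]] :=
    spectral_splitting Mds hM.
  have sp : (hp <= hp')%VS.
    apply/subvP=> y py; apply: hpM; last exact: hpP.
    by rewrite -sum; apply: (subvP (addvSl _ _)).
  have sm : (hm <= hm')%VS.
    apply/subvP=> y my; apply: hmM; last exact: hmP.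
    by rewrite -sum; apply: (subvP (addvSr _ _)).
  have := dimv_disjoint_sum cap; have := dimv_disjoint_sum cap'.
  rewrite sum sum'; have := dimvS sp; have := dimvS sm.
  move=> d1 d2 d3 d4; exists (vsval x), ds; split=> //; lia.
split; first exact: (Bsub_polynomials_cartan Mds hM).
have [hp [hm [spl dp dq _ _]]] := spectral_splitting Mds hM.
by exists hp, hm; rewrite -szp -szq.
Qed.

End Splitting.

(** * Direct sums of affine algebras *)

Lemma linear_inj_dim (F : fieldType) (V W : vectType F) (f : {linear V -> W}) :
  injective f -> (dim V <= dim W)%N.
Proof.
move=> finj; have : lker (linfun f) == 0%VS
  by apply/lker0P=> x y; rewrite !lfunE => /finj.
move=> /eqP ker0; rewrite -(dimvf V) -(dimvf W).
rewrite -(@limg_dim_eq _ _ _ (linfun f) {:V}) ?ker0 ?capv0 //.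
exact/dimvS/subvf.
Qed.

Lemma linear_inj_bij (F : fieldType) (V W : vectType F) (f : {linear V -> W}) :
  injective f -> dim V = dim W -> bijective f.
Proof.
move=> finj dVW; have ker0 : lker (linfun f) == 0%VS
  by apply/lker0P=> x y; rewrite !lfunE => /finj.
have limf : limg (linfun f) = {:W}%VS.
  apply/eqP; rewrite eqEdim subvf limg_dim_eq ?(eqP ker0) ?capv0 //.
  by rewrite !dimvf dVW leqnn.
exists (linfun f)^-1%VF => x; first by rewrite -[f x]lfunE lker0_lfunK.
by rewrite -[LHS]lfunE limg_lfunVK // limf memvf.
Qed.

Section AffCoordinates.
Variable R : fieldType.

Definition affR_of (a b : R) : affR R := \row_(k < 2) [:: a; b]`_k.
Definition affC_of (a b c d : R) : affC R := \row_(k < 4) [:: a; b; c; d]`_k.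

Lemma affR_eta (x : affR R) : x = affR_of (x 0 0) (x 0 1).
Proof. by apply/rowP=> -[[|[|//]] lt]; rewrite mxE /=; congr (x 0 _);
  apply: val_inj. Qed.

Lemma affC_eta (x : affC R) : x = affC_of (x 0 0) (x 0 1) (x 0 2%:R) (x 0 3%:R).
Proof. by apply/rowP=> -[[|[|[|[|//]]]] lt]; rewrite mxE /=; congr (x 0 _);
  apply: val_inj. Qed.

Lemma affR_of_lieb a b a' b' :
  [lie affR_of a b, affR_of a' b'] = affR_of 0 (a * b' - b * a').
Proof. by apply/rowP=> -[[|[|//]] lt]; rewrite !mxE /=. Qed.

(** With s = a + i b and v = c + i d this is [(s, v), (s', v')] = (0, s v' - s' v) over C. *)
Lemma affC_of_lieb a b c d a' b' c' d' :
  [lie affC_of a b c d, affC_of a' b' c' d'] =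
  affC_of 0 0 (a * c' - c * a' - (b * d' - d * b'))
    (a * d' - d * a' + (b * c' - c * b')).
Proof. by apply/rowP=> -[[|[|[|[|//]]]] lt]; rewrite !mxE /=. Qed.

Lemma affR_of_linear k a b a' b' :
  k *: affR_of a b + affR_of a' b' = affR_of (k * a + a') (k * b + b').
Proof. by apply/rowP=> -[[|[|//]] lt]; rewrite !mxE /=. Qed.

Lemma affC_of_linear k a b c d a' b' c' d' :
  k *: affC_of a b c d + affC_of a' b' c' d' =
  affC_of (k * a + a') (k * b + b') (k * c + c') (k * d + d').
Proof. by apply/rowP=> -[[|[|[|[|//]]]] lt]; rewrite !mxE /=. Qed.

Lemma affR_of_inj a b a' b' : affR_of a b = affR_of a' b' -> a = a' /\ b = b'.
Proof. by move=> /rowP e; have := (e 0, e 1); rewrite !mxE /= => -[]. Qed.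

Lemma affC_of_inj a b c d a' b' c' d' :
  affC_of a b c d = affC_of a' b' c' d' -> [/\ a = a', b = b', c = c' & d = d'].
Proof. by move=> /rowP e; have := (e 0, e 1, e 2%:R, e 3%:R);
  rewrite !mxE /= => -[[[]]]. Qed.

Lemma affR0 : 0 = affR_of 0 0.
Proof. by apply/rowP=> -[[|[|//]] lt]; rewrite !mxE. Qed.

Lemma affC0 : 0 = affC_of 0 0 0 0.
Proof. by apply/rowP=> -[[|[|[|[|//]]]] lt]; rewrite !mxE. Qed.

End AffCoordinates.

(** * From polynomials in a matrix to the affine sum *)

Section PolynomialsAff.
Variables (R : realType) (n : nat).
Local Notation C := R[i].
Local Notation toC := (real_complex R).
Local Notation polyC_of := (map_poly toC).
Local Notation L := (sl R n.+1).
Implicit Types (h : {liesub L}) (M : 'M[R]_n.+1).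

Lemma conj_closed_eq0 M ds (g : C -> C) : simple_spectrum M ds ->
    {in ds, forall a, g (conjc a) = conjc (g a)} ->
    {in upper ds, forall a, g a = 0} ->
    {in reals ds, forall a, complex.Re (g a) = 0} ->
  {in ds, forall a, g a = 0}.
Proof.
move=> Mds gJ gu gr a da.
have [im|im|im] := ltgtP 0 (complex.Im a).
- by apply: gu; rewrite mem_filter im.
- have := gu (conjc a);
    rewrite mem_filter Im_conjc oppr_gt0 im (simple_conj Mds) // => /(_ isT).
  by rewrite gJ // => /eqP; rewrite conjc_eq0 => /eqP.
- apply: complexP; first by apply: gr; rewrite mem_filter -im eqxx.
  have := gJ a da; have /eqP<- : a == conjc a by rewrite conjcP im.
  by move/(congr1 (@complex.Im R)); rewrite Im_conjc /=; lra.
Qed.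

Lemma aff_of_polynomials h M ds :
    simple_spectrum M ds -> Bsub_polynomials h M ->
  lie_isomorphic (semidirect (Bsub h))
    ({ffun 'I_(size (upper ds)) -> affC R} *
      {ffun 'I_(size (reals ds)) -> affR R})%type.
Proof.
move=> Mds hM; set p := size (upper ds); set q := size (reals ds).
have [U [U0 UM UJ]] := simple_eigenvectors Mds.
pose G := semidirect (Bsub h).
(* For u = (A, x), [e] is the eigenvalue of A on the left eigenvector at z and [w] the value of that
   covector on x. As A x is sent to [e] times [w], the pair obeys the affine bracket. *)
pose e z (u : G) := ev U z (vsval u.1).
pose w z (u : G) := (U z *m mxC u.2) 0 0.
pose lam (k : 'I_p) := (upper ds)`_k; pose rho (l : 'I_q) := (reals ds)`_l.
have lamP k : lam k \in ds.
  have : lam k \in upper ds by rewrite mem_nth.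
  by rewrite mem_filter => /andP[].
have rhoP l : rho l \in ds /\ complex.Im (rho l) = 0.
  have : rho l \in reals ds by rewrite mem_nth.
  by rewrite mem_filter => /andP[/eqP].
have uP (u : G) : exists P, vsval u.1 = horner_mx M P.
  by apply/hM; apply: subvsP.
have eJ z u : z \in ds -> e (conjc z) u = conjc (e z u).
  move=> dz; have [P uE] := uP u.
  by rewrite /e uE !(ev_horner U0 UM) ?(simple_conj Mds) // horner_real_conj.
have wJ z u : z \in ds -> w (conjc z) u = conjc (w z u).
  move=> dz; rewrite /w UJ // -[mxC _ in LHS]mxJC -mxJM.
  by rewrite [mxJ _ _ _]mxE.
have Ue z u : z \in ds -> U z *m mxC (vsval u.1) = e z u *: U z.
  move=> dz; have [P uE] := uP u.
  by rewrite /e uE (ev_horner U0 UM) // (eigen_horner_mxC _ (UM _ dz)).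
have elin z k (u v : G) : e z (k *: u + v) = toC k * e z u + e z v.
  rewrite /e; have -> : (k *: u + v).1 = k *: u.1 + v.1 by [].
  by rewrite linearD linearZ ev_linear.
have wlin z k (u v : G) : w z (k *: u + v) = toC k * w z u + w z v.
  rewrite /w; have -> : (k *: u + v).2 = k *: u.2 + v.2 by [].
  by rewrite mxCD [mxC (k *: _)]map_mxZ mulmxDr -scalemxAr !mxE.
have elie z (u v : G) : z \in ds -> e z [lie u, v] = 0.
  move=> dz; have [P uE] := uP u; have [Q vE] := uP v.
  rewrite /e; have -> : vsval [lie u, v].1 = [lie vsval u.1, vsval v.1]
    by exact: val_sub_lieb.
  by rewrite uE vE lieb_horner_mx /ev /mxC map_mx0 mulmx0 mul0mx mxE.
have wlie z (u v : G) : z \in ds ->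
  w z [lie u, v] = e z u * w z v - e z v * w z u.
  move=> dz; rewrite /w semi_liebE /=
    mxCB !mxCM mulmxBr !mulmxA !Ue // -!scalemxAl.
  by rewrite !mxE.
pose f (u : G) : ({ffun 'I_p -> affC R} * {ffun 'I_q -> affR R})%type :=
  ([ffun k => affC_of (complex.Re (e (lam k) u)) (complex.Im (e (lam k) u))
    (complex.Re (w (lam k) u)) (complex.Im (w (lam k) u))],
   [ffun l => affR_of (complex.Re (e (rho l) u)) (complex.Re (w (rho l) u))]).
have flin : linear f.
  move=> k u v; rewrite /f; congr (_, _); apply/ffunP=> i; rewrite !ffunE.
    by rewrite [RHS]affC_of_linear !elin !wlin !Re_linear !Im_linear.
  by rewrite [RHS]affR_of_linear !elin !wlin !Re_linear.
pose F : {linear G -> ({ffun 'I_p -> affC R} * {ffun 'I_q -> affR R})%type} :=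
  HB.pack f (GRing.isLinear.Build R _ _ _ f flin).
exists F; split; last first.
  move=> u v; rewrite /= /f; congr (_, _); apply/ffunP=> i; rewrite !ffunE.
    rewrite affC_of_lieb elie // wlie //.
    case: (e (lam i) u) (e (lam i) v) (w (lam i) u) (w (lam i) v) => [a b]
      [a' b'] [c d] [c' d'].
    by congr affC_of => /=; ring.
  have [drho imrho] := rhoP i.
  have eIm x : complex.Im (e (rho i) x) = 0.
    have := eJ (rho i) x drho; have /eqP<- : rho i == conjc (rho i)
      by rewrite conjcP imrho.
    by move/(congr1 (@complex.Im R)); rewrite Im_conjc; lra.
  rewrite affR_of_lieb elie // wlie //; have := eIm u; have := eIm v.
  case: (e (rho i) u) (e (rho i) v) (w (rho i) u) (w (rho i) v) => [a b]
    [a' b'] [c d] [c' d'] /= -> ->.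
  by congr affR_of; ring.
(* Both sides have dimension 2 (n + 1) = 4p + 2q, so injectivity suffices. *)
apply: linear_inj_bij.
  apply: raddf_inj => u /= [/ffunP f1 /ffunP f2].
  have fu z : z \in upper ds -> e z u = 0 /\ w z u = 0.
    move=> uz; have iz : (index z (upper ds) < p)%N by rewrite index_mem.
    have := f1 (Ordinal iz); rewrite !ffunE /lam /=
      nth_index // affC0 => /affC_of_inj[].
    by move=> *; split; apply: complexP.
  have fr z : z \in reals ds ->
    complex.Re (e z u) = 0 /\ complex.Re (w z u) = 0.
    move=> rz; have iz : (index z (reals ds) < q)%N by rewrite index_mem.
    by have := f2 (Ordinal iz);
      rewrite !ffunE /rho /= nth_index // affR0 => /affR_of_inj[].
  have e0 : {in ds, forall z, e z u = 0}.
    apply: (conj_closed_eq0 Mds) => z; [exact: eJ | by case/fu | by case/fr].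
  have w0 : {in ds, forall z, w z u = 0}.
    apply: (conj_closed_eq0 Mds) => z; [exact: wJ | by case/fu | by case/fr].
  have [P uE] := uP u.
  have u1 : u.1 = 0.
    apply: subvs_inj; rewrite linear0 uE;
      apply: (horner_mx_simple_eq0 Mds) => z dz.
    by rewrite -(ev_horner U0 UM) // -uE; apply: e0.
  have u2 : u.2 = 0.
    apply: (@mxC_inj R); rewrite [mxC 0]map_mx0;
      apply: (eigenvectors_span Mds U0 UM) => z dz.
    by apply/matrixP=> i j; rewrite !ord1 [RHS]mxE; apply: w0.
  by case: u u1 u2 {f1 f2 fu fr e0 w0 uE} => x y /= -> ->.
have dimB : \dim (Bsub h) = n.+1 := dim_in_polynomials Mds hM.
have -> : dim G = (\dim (Bsub h) + n.+1 * 1)%N by [].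
rewrite dimB.
have -> : dim ({ffun 'I_p -> affC R} * {ffun 'I_q -> affR R})%type =
  (#|'I_p| * (1 * 4) + #|'I_q| * (1 * 2))%N by [].
rewrite !card_ord; have := simple_spectrum_size Mds; rewrite -/p -/q; lia.
Qed.

End PolynomialsAff.

Section AffSum.
Variables (F : fieldType) (p q : nat).
Local Notation T := ({ffun 'I_p -> affC F} * {ffun 'I_q -> affR F})%type.
Implicit Types s t : T.

(* The components along e3, e4 in aff(C) and e2 in aff(R) are arbitrary. *)
Definition aff_sum_derived t :=
  (forall k, t.1 k 0 0 = 0 /\ t.1 k 0 1 = 0) /\ (forall l, t.2 l 0 0 = 0).

Lemma aff_sum_lieb1 s t k :
  [lie s, t].1 k = [lie s.1 k, t.1 k].
Proof. by rewrite [LHS]ffunE. Qed.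

Lemma aff_sum_lieb2 s t l :
  [lie s, t].2 l = [lie s.2 l, t.2 l].
Proof. by rewrite [LHS]ffunE. Qed.

Lemma aff_sum_lieb_derived s t : aff_sum_derived [lie s, t].
Proof.
split=> [k|l]; first
  by rewrite aff_sum_lieb1 [s.1 k]affC_eta [t.1 k]affC_eta affC_of_lieb !mxE.
by rewrite aff_sum_lieb2 [s.2 l]affR_eta [t.2 l]affR_eta affR_of_lieb !mxE.
Qed.

Lemma aff_sum_linear1 a s t k i :
  (a *: s + t).1 k 0 i = a * s.1 k 0 i + t.1 k 0 i.
Proof. by rewrite [LHS](congr1 (fun x : affC F => x 0 i) (ffunE _ k)) ffunE
  !mxE. Qed.

Lemma aff_sum_linear2 a s t l i :
  (a *: s + t).2 l 0 i = a * s.2 l 0 i + t.2 l 0 i.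
Proof. by rewrite [LHS](congr1 (fun x : affR F => x 0 i) (ffunE _ l)) ffunE
  !mxE. Qed.

(** On the derived algebra it acts as multiplication by a k + i b k on the k-th plane and by c l on
    the l-th line. *)
Definition aff_sum_torus (a b : 'I_p -> F) (c : 'I_q -> F) : T :=
  ([ffun k => affC_of (a k) (b k) 0 0], [ffun l => affR_of (c l) 0]).

Lemma aff_sum_torus_lieb1 a b c t k : aff_sum_derived t ->
  [lie aff_sum_torus a b c, t].1 k =
  affC_of 0 0 (a k * t.1 k 0 2%:R - b k * t.1 k 0 3%:R)
    (a k * t.1 k 0 3%:R + b k * t.1 k 0 2%:R).
Proof.
move=> [/(_ k)[t0 t1] _];
  rewrite aff_sum_lieb1 ffunE [in LHS](affC_eta (t.1 k)) affC_of_lieb.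
by rewrite t0 t1; congr affC_of; ring.
Qed.

Lemma aff_sum_torus_lieb2 a b c t l : aff_sum_derived t ->
  [lie aff_sum_torus a b c, t].2 l = affR_of 0 (c l * t.2 l 0 1).
Proof.
move=> [_ /(_ l) t0];
  rewrite aff_sum_lieb2 ffunE [in LHS](affR_eta (t.2 l)) affR_of_lieb.
by rewrite t0; congr affR_of; ring.
Qed.

(** This torus element exhibits every element of the derived algebra as a bracket. *)
Lemma aff_sum_torus1_lieb t : aff_sum_derived t ->
  [lie aff_sum_torus (fun=> 1) (fun=> 0) (fun=> 1), t] = t.
Proof.
move=> Dt; have [D1 D2] := Dt; apply: injective_projections; apply/ffunP=> k.
  rewrite aff_sum_torus_lieb1 // [RHS]affC_eta; have [-> ->] := D1 k.
  by congr affC_of; ring.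
by rewrite aff_sum_torus_lieb2 // [RHS]affR_eta D2 mul1r.
Qed.

Lemma aff_sum_derived_abelian s t : aff_sum_derived s -> aff_sum_derived t ->
  [lie s, t] = 0.
Proof.
move=> [s1 s2] [t1 t2]; apply: injective_projections; apply/ffunP=> k.
  rewrite aff_sum_lieb1 (affC_eta (s.1 k)) (affC_eta (t.1 k)) affC_of_lieb
    ffunE [RHS]affC0.
  by have [-> ->] := s1 k; have [-> ->] := t1 k; congr affC_of; ring.
rewrite aff_sum_lieb2 (affR_eta (s.2 k)) (affR_eta (t.2 k)) affR_of_lieb ffunE
  [RHS]affR0.
by rewrite s2 t2; congr affR_of; ring.
Qed.

End AffSum.

(** * From the affine sum back to a matrix *)

Section AffPolynomials.
Variables (R : realType) (n : nat).
Local Notation C := R[i].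
Local Notation toC := (real_complex R).
Local Notation L := (sl R n.+1).
Implicit Types (h : {liesub L}) (M : 'M[R]_n.+1).

(** The values of [phi] on the standard basis form a complex left eigenvector. *)
Lemma eigenvalueC_functional M (phi : 'cV[R]_n.+1 -> C) z v0 :
    (forall (a : R) v w, phi (a *: v + w) = toC a * phi v + phi w) ->
    (forall v, phi (M *m v) = z * phi v) -> phi v0 != 0 ->
  eigenvalueC M z.
Proof.
move=> plin pM nz0.
have p0 : phi 0 = 0.
  by have := plin 1 0 0; rewrite scale1r addr0 rmorph1 mul1r => /esym/eqP;
    rewrite -subr_eq0 addrK => /eqP.
have psum (v : 'cV[R]_n.+1) : phi v = \sum_i toC (v i 0) * phi (delta_mx i 0).
  have {1}-> : v = \sum_i v i 0 *: delta_mx i 0.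
    by rewrite {1}[v]matrix_sum_delta; apply: eq_bigr => i _; rewrite big_ord1.
  by elim: index_enum => [|i r IH]; rewrite ?big_nil // !big_cons plin IH.
apply/eigenvalueP; exists (\row_i phi (delta_mx i 0)); last first.
  apply: contraNneq nz0 => /rowP e0; rewrite psum big1 // => i _.
  by have := e0 i; rewrite !mxE => ->; rewrite mulr0.
apply/rowP=> j; rewrite [LHS]mxE [RHS]mxE [in RHS]mxE -pM psum -colE.
by apply: eq_bigr => i _; rewrite !mxE mulrC.
Qed.

Lemma polynomials_of_aff h p q :
    lie_isomorphic (semidirect (Bsub h))
      ({ffun 'I_p -> affC R} * {ffun 'I_q -> affR R})%type ->
  exists M ds, [/\ simple_spectrum M ds, Bsub_polynomials h M,
     size (upper ds) = p & size (reals ds) = q].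
Proof.
set T := ({ffun 'I_p -> affC R} * {ffun 'I_q -> affR R})%type.
set G := semidirect (Bsub h) => -[f [[g fK gK] flie]].
have finj := can_inj fK.
have B1 : 1%:M \in Bsub h by apply/BsubP; exists 1, 0;
  rewrite ?mem0v // linear0 addr0.
pose toG (A : 'M[R]_n.+1) (v : 'cV[R]_n.+1) : G := (vsproj (Bsub h) A, v).
have toG_lie A v A' v' : A \in Bsub h -> A' \in Bsub h ->
    [lie toG A v, toG A' v'] = toG [lie A, A'] (A *m v' - A' *m v).
  move=> hA hA'; rewrite semi_liebE; congr (_, _); last by rewrite !vsprojK.
  by apply: subvs_inj; rewrite [LHS]val_sub_lieb !vsprojK // memv_lieb.
have hB0 : 0 \in Bsub h by exact: mem0v.
have G1 v : [lie toG 1%:M 0, toG 0 v] = toG 0 v.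
  by rewrite toG_lie // linear0 mul1mx mul0mx subr0.
have iotaD v : aff_sum_derived (f (toG 0 v))
  by rewrite -G1 flie; apply: aff_sum_lieb_derived.
(* With C = [A, A'], both (C, 0) and (0, v) are brackets, hence map into the abelian derived
   algebra; so C v = 0 for every v. *)
have Bcomm A A' : A \in Bsub h -> A' \in Bsub h -> [lie A, A'] = 0.
  move=> hA hA'.
  have brA : [lie toG A 0, toG A' 0] = toG [lie A, A'] 0.
    by rewrite toG_lie // !mulmx0 subr0.
  apply: trmx_inj; apply/row_matrixP=> j; rewrite -!tr_col; congr trmx.
  rewrite col0 colE; set v := delta_mx j 0.
  have : [lie toG [lie A, A'] 0, toG 0 v] = 0.
    apply: finj; rewrite flie linear0 aff_sum_derived_abelian //.
    by rewrite -brA flie; apply: aff_sum_lieb_derived.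
  by rewrite toG_lie ?memv_lieb // mul0mx subr0 => /(congr1 snd).
have toG_eta (u : G) : u = toG (vsval u.1) u.2
  by case: u => a v; rewrite /toG vsvalK.
(* As t is a bracket, so is its preimage, whose matrix part vanishes by [Bcomm]. *)
have derivedP t : aff_sum_derived t -> exists v, f (toG 0 v) = t.
  move=> Dt; exists (g t).2; rewrite -[RHS]gK [g t in RHS]toG_eta;
    congr (f (toG _ _)).
  have -> : g t = [lie g (aff_sum_torus (fun=> 1) (fun=> 0) (fun=> 1)), g t].
    by apply: finj; rewrite flie !gK aff_sum_torus1_lieb.
  by rewrite [RHS]val_sub_lieb Bcomm ?subvsP.
(* M will have the distinct eigenvalues k + i, k - i (k < p) and l (l < q). *)
pose t0 : T := aff_sum_torus (fun k : 'I_p => k%:R) (fun=> 1)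
  (fun l : 'I_q => l%:R).
pose M := vsval (g t0).1.
have hM : M \in Bsub h by exact: subvsP.
have actM v : f (toG 0 (M *m v)) = [lie t0, f (toG 0 v)].
  by rewrite -[t0]gK -flie [g t0]toG_eta toG_lie // linear0 mul0mx subr0.
have flin a v w : f (toG 0 (a *: v + w)) = a *: f (toG 0 v) + f (toG 0 w).
  have z0 : vsproj (Bsub h) 0 = 0 by exact: linear0.
  rewrite -linearP; congr (f _); apply: injective_projections => //.
  by rewrite [LHS]z0 [RHS](congr2 (fun x y => a *: x + y) z0 z0) scaler0 addr0.
(* Coordinates of the derived algebra pulled back to R^n: functionals that M multiplies by k + i and
   by l. *)
pose phi k v : C := Complex ((f (toG 0 v)).1 k 0 2%:R)
  ((f (toG 0 v)).1 k 0 3%:R).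
pose psi l v : C := toC ((f (toG 0 v)).2 l 0 1).
have ev1 (k : 'I_p) : eigenvalueC M (Complex k%:R 1 : C).
  pose t : T := ([ffun j => affC_of 0 0 (j == k)%:R 0], 0).
  have [|v vE] := derivedP t; first by split=> i; rewrite ffunE !mxE.
  apply: (@eigenvalueC_functional M (phi k) _ v) => [a u w|u|].
  - by rewrite /phi flin; apply: complexP; rewrite /= !aff_sum_linear1; ring.
  - by rewrite /phi actM aff_sum_torus_lieb1 // !mxE; apply: complexP => /=;
      ring.
  - by rewrite /phi vE /= !ffunE !mxE eqxx eq_complex /= oner_eq0.
have ev2 (l : 'I_q) : eigenvalueC M (toC l%:R).
  pose t : T := (0, [ffun j => affR_of 0 (j == l)%:R]).
  have [|v vE] := derivedP t; first by split=> i; rewrite ffunE !mxE.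
  apply: (@eigenvalueC_functional M (psi l) _ v) => [a u w|u|].
  - by rewrite /psi flin aff_sum_linear2; apply: complexP => /=; ring.
  - by rewrite /psi actM aff_sum_torus_lieb2 // !mxE; apply: complexP => /=;
      ring.
  - by rewrite /psi vE /= !ffunE !mxE eqxx oner_eq0.
pose lam := [seq (Complex k%:R 1 : C) | k <- iota 0 p].
pose rho := [seq toC k%:R | k <- iota 0 q].
pose ds := lam ++ map conjc lam ++ rho.
have uds : uniq ds.
  have ulam : uniq lam.
    by rewrite map_inj_uniq ?iota_uniq // => i j [] /eqP;
      rewrite eqr_nat => /eqP.
  have lamIm z : z \in lam -> complex.Im z = 1 by case/mapP=> i _ ->.
  have rhoIm z : z \in rho -> complex.Im z = 0 by case/mapP=> i _ ->.
  rewrite !cat_uniq ulam map_inj_uniq ?ulam; last exact: can_inj (@conjcK R).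
  rewrite map_inj_uniq ?iota_uniq ?andbT /=; last first.
    by move=> i j [] /eqP; rewrite eqr_nat => /eqP.
  apply/andP; split; apply/hasPn=> z.
    rewrite mem_cat => /orP[/mapP[w /lamIm wIm ->]|/rhoIm zIm];
      apply/negP => /lamIm.
      by rewrite Im_conjc wIm; lra.
    by rewrite zIm; lra.
  move=> /rhoIm zIm; apply/mapP => -[w /lamIm wIm zE].
  by move: zIm; rewrite zE Im_conjc wIm; lra.
have evds : {in ds, forall z, eigenvalueC M z}.
  have evlam z : z \in lam -> eigenvalueC M z.
    by case/mapP=> i; rewrite mem_iota add0n => /= lip ->;
      exact: (ev1 (Ordinal lip)).
  have evrho z : z \in rho -> eigenvalueC M z.
    by case/mapP=> i; rewrite mem_iota add0n => /= liq ->;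
      exact: (ev2 (Ordinal liq)).
  move=> z; rewrite !mem_cat => /or3P[/evlam//|/mapP[w /evlam + ->]|/evrho//].
  exact: eigenvalueCJ.
have szds : size ds = (2 * p + q)%N.
  by rewrite !size_cat !size_map !size_iota; lia.
have leN : (2 * p + q <= n.+1)%N.
  have nz : map_poly toC (char_poly M) != 0
    by rewrite map_poly_eq0 monic_neq0 ?char_poly_monic.
  have := max_poly_roots nz (_ : all _ ds) uds.
  rewrite szds size_map_poly size_char_poly ltnS; apply.
  by apply/allP=> z /evds; rewrite eigenvalueC_root.
(* The same coordinates embed R^n into a space of dimension 2p + q, the counterpart of the bound by
   distinct eigenvalues. *)
have geN : (n.+1 <= 2 * p + q)%N.
  pose K (v : 'cV[R]_n.+1) : ('rV[R]_p * 'rV[R]_p * 'rV[R]_q)%type :=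
    (\row_k (f (toG 0 v)).1 k 0 2%:R, \row_k (f (toG 0 v)).1 k 0 3%:R,
     \row_l (f (toG 0 v)).2 l 0 1).
  have Klin : linear K.
    move=> a v w; rewrite /K flin; congr (_, _, _); apply/rowP=> i;
      by rewrite !mxE ?aff_sum_linear1 ?aff_sum_linear2.
  pose KL : {linear 'cV[R]_n.+1 -> ('rV[R]_p * 'rV[R]_p * 'rV[R]_q)%type} :=
    HB.pack K (GRing.isLinear.Build R _ _ _ K Klin).
  have : injective KL.
    apply: raddf_inj => v [/rowP K1 /rowP K2 /rowP K3].
    suff : f (toG 0 v) = f 0 by move/finj/(congr1 snd).
    rewrite linear0; have [D1 D2] := iotaD v; apply: injective_projections;
      apply/ffunP=> k.
      rewrite [LHS]affC_eta ffunE [RHS]affC0; have [-> ->] := D1 k.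
      by have := K1 k; have := K2 k; rewrite !mxE => -> ->.
    rewrite [LHS]affR_eta ffunE [RHS]affR0 D2.
    by have := K3 k; rewrite !mxE => ->.
  move/linear_inj_dim;
    rewrite -[dim _]/(n.+1 * 1)%N -[X in (_ <= X)%N]/(1 * p + 1 * p + 1 * q)%N;
    lia.
have Mds : simple_spectrum M ds by split=> //; rewrite szds; lia.
exists M, ds; split=> //.
- move=> A; have [V VP] : exists V : {vspace 'M[R]_n.+1}, forall A, A \in V <->
    in_polynomials M A.
    apply: vspace_comprehension; first by exists 0; rewrite linear0.
    by move=> a x y [P ->] [Q ->]; exists (a *: P + Q); rewrite linearP.
  (* R I + h is abelian and contains M, so it lies in the commutant R[M]; the dimension 2 (n + 1) of
     the affine sum leaves at least n + 1 for it, which forces equality. *)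
  have BV : (Bsub h <= V)%VS.
    by apply/subvP=> X hX; apply/VP/(simple_commutant Mds); apply: Bcomm.
  suff /eqP-> : Bsub h == V :> {vspace _} by [].
  rewrite eqEdim BV (dim_in_polynomials Mds VP).
  have : (dim T <= dim G)%N.
    pose gL : {linear T -> G} :=
      HB.pack g (GRing.isLinear.Build R _ _ _ g (can2_linear fK gK)).
    exact: (@linear_inj_dim _ _ _ gL (can_inj gK)).
  rewrite -[dim G]/(\dim (Bsub h) + n.+1 * 1)%N
    -[dim T]/(#|'I_p| * (1 * 4) + #|'I_q| * (1 * 2))%N.
  rewrite !card_ord; lia.
- rewrite size_filter !count_cat !count_map.
  rewrite (eq_count (a2 := predT)) ?count_predT => [|k /=]; last exact: ltr01.
  rewrite (eq_count (a2 := pred0)) ?count_pred0 => [|k /=]; last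
    by rewrite oppr_gt0 ltr10.
  rewrite (eq_count (a2 := pred0)) ?count_pred0 => [|k /=]; last
    by rewrite ltxx.
  by rewrite size_iota !addn0.
rewrite size_filter !count_cat !count_map.
rewrite (eq_count (a2 := pred0)) ?count_pred0 => [|k /=]; last
  by rewrite oner_eq0.
rewrite (eq_count (a2 := pred0)) ?count_pred0 => [|k /=]; last
  by rewrite oppr_eq0 oner_eq0.
rewrite (eq_count (a2 := predT)) ?count_predT => [|k /=]; last by rewrite eqxx.
by rewrite size_iota.
Qed.

End AffPolynomials.

Theorem theorem3 (R : realType) (n : nat) (h : {liesub sl R n.+1})
    (p q : nat) :
  let a := cartan h /\
    exists hp hm : {liesub sl R n.+1},
      [/\ toroidal_vector_split h hp hm,
          \dim hp = p & (\dim hm + 1 = p + q)%N] in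
  let b := exists M : 'M[R]_n.+1,
      [/\ forall A, A \in Bsub h <-> in_polynomials M A,
          nonderogatory M,
          distinct_eigenvalues M (2 * p) q
        & (2 * p + q = n.+1)%N] in
  let c := lie_isomorphic (semidirect (Bsub h))
      ({ffun 'I_p -> affC R} * {ffun 'I_q -> affR R})%type in
  (a <-> b) /\ (b <-> c).
Proof.
move=> a b c.
have bP : b <-> exists M ds, [/\ simple_spectrum M ds, Bsub_polynomials h M,
    size (upper ds) = p & size (reals ds) = q].
  split=> [[M [hM _ eM szM]]|[M [ds [Mds hM szp szq]]]].
    have [ds [Mds szp szq]] := (simple_spectrum_distinct M p q).1 (conj eM szM).
    by exists M, ds.
  have [|eM szM] := (simple_spectrum_distinct M p q).2; first by exists ds.
  by exists M; split=> //; apply: simple_nonderogatory Mds.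
split.
  by apply: (iff_trans (cartan_iff_polynomials h p q)); apply: iff_sym.
apply: (iff_trans bP); split=> [[M [ds [Mds hM szp szq]]]|];
  last exact: polynomials_of_aff.
by rewrite /c -szp -szq; apply: aff_of_polynomials Mds hM.
Qed.
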